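(* There is a universal constant $\Theta\in(0,+\infty)$ with the following property. Let $n\ge 3$ be an integer, let $R\in(0,+\infty)$, and let $$X(x,y)=(x,y,\varphi_1(x,y),\ldots,\varphi_{n-2}(x,y)),\quad (x,y)\in\overline B_R,$$ be a minimal surface graph in $\mathbb R^n$ with $\varphi_\Sigma\in C^2(\overline B_R,\mathbb R)$ for $\Sigma=1,\ldots,n-2$. Let $X=X(u,v)$, $(u,v)\in\overline B$, denote the graph in conformal parameters on the closed unit disc $\overline B$, normalized so that $(u,v)=(0,0)$ corresponds to $(x,y)=(0,0)$ (as described in the context). Then for every unit normal vector field $N$ of $X$, the principal curvatures $\kappa_{N,1},\kappa_{N,2}$ in direction of $N$ satisfy $$\kappa_{N,1}(0,0)^2+\kappa_{N,2}(0,0)^2\le\frac{1}{R^4}\,\Theta\,\|X\|_{C^0(B)}^2,$$ where $\|X\|_{C^0(B)}:=\sup_{(u,v)\in B}|X(u,v)|$.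
   Context: Notation: $B_R:=\{(x,y)\in\mathbb R^2: x^2+y^2<R^2\}$, $\overline B_R$ is its closure, $\partial B_R$ its boundary, and $B:=B_1$. $|\cdot|$ is the Euclidean norm and $\cdot$ the Euclidean inner product in $\mathbb R^n$. Conformal parameters: the graph is reparametrized as an immersion $X(u,v)=(x^1(u,v),\ldots,x^n(u,v))$, $(u,v)\in\overline B$, of class $C^2(B,\mathbb R^n)\cap C^0(\overline B,\mathbb R^n)$, (so that $x^{2+\Sigma}(u,v)=\varphi_\Sigma(x^1(u,v),x^2(u,v))$ for $\Sigma=1,\ldots,n-2$), such that: (a) the plane mapping $F^*(u,v):=(x^1(u,v),x^2(u,v)):\overline B\to\overline B_R$ is one-to-one, has positive Jacobian, satisfies $F^*(0,0)=(0,0)$, and $F^*:\partial B\to\partial B_R$ is a topological mapping (homeomorphism); (b) the conformality relations $|X_u|^2=W=|X_v|^2$, $X_u\cdot X_v=0$ hold in $B$, where, with $u^1=u$, $u^2=v$, $h_{ij}:=X_{u^i}\cdot X_{u^j}$ and $W:=\sqrt{h_{11}h_{22}-h_{12}^2}$. Curvatures: for a differentiable unit normal vector field $N=N(u,v)$ (so $|N|=1$, $N\cdot X_u=N\cdot X_v=0$), put $L_{N,ij}:=X_{u^iu^j}\cdot N$, and define the mean curvature and Gaussian curvature in direction of $N$ by $$H_N:=\frac{L_{N,11}h_{22}-2L_{N,12}h_{12}+L_{N,22}h_{11}}{2W^2},\qquad K_N:=\frac{L_{N,11}L_{N,22}-L_{N,12}^2}{W^2}.$$ The principal curvatures $\kappa_{N,1},\kappa_{N,2}$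 in direction of $N$ are the corresponding numbers with $H_N=\tfrac12(\kappa_{N,1}+\kappa_{N,2})$ and $K_N=\kappa_{N,1}\kappa_{N,2}$, i.e. the eigenvalues of $(L_{N,ij})$ with respect to $(h_{ij})$. The surface is minimal if its mean curvature vector vanishes, equivalently $H_N\equiv 0$ for all unit normal vector fields $N$. *)

(* Defs.v *)
From HB Require Import structures.
From mathcomp Require Import all_boot all_order all_algebra.
From mathcomp Require Import all_classical all_reals all_analysis.
Set Implicit Arguments.
Unset Strict Implicit.
Unset Printing Implicit Defensive.
Import Order.TTheory GRing.Theory Num.Theory.
Import numFieldNormedType.Exports.
Local Open Scope classical_set_scope.
Local Open Scope ring_scope.

(* The library norms on [R * R] and ['rV[R]_k] are max norms; they are used only
   for their topology. All metric notions go through [dot] and [enorm]. *)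
Definition dot (R : realType) (k : nat) (x y : 'rV[R]_k) : R :=
  \sum_(i < k) x 0 i * y 0 i.

Definition enorm (R : realType) (k : nat) (x : 'rV[R]_k) : R :=
  Num.sqrt (dot x x).

Definition disc (R : realType) (r : R) : set (R * R) :=
  [set p | p.1 ^+ 2 + p.2 ^+ 2 < r ^+ 2].

Definition boundary (T : topologicalType) (A : set T) : set T :=
  closure A `\` interior A.

(* ['D_e1] and ['D_e2] are the partial derivatives in the two plane variables. *)
Definition e1 {R : realType} : R * R := (1, 0).
Definition e2 {R : realType} : R * R := (0, 1).

Definition C1_on (R : realType) (V : normedModType R) (U : set (R * R))
    (f : R * R -> V) : Prop :=
  forall p, U p ->
    [/\ derivable f p e1, derivable f p e2,
        {for p, continuous ('D_e1 f)} & {for p, continuous ('D_e2 f)}].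

(* Meant for open [U]. *)
Definition C2_on (R : realType) (V : normedModType R) (U : set (R * R))
    (f : R * R -> V) : Prop :=
  [/\ C1_on U f, C1_on U ('D_e1 f) & C1_on U ('D_e2 f)].

Definition extends_continuously (R : realType) (V : normedModType R)
    (U : set (R * R)) (f : R * R -> V) : Prop :=
  exists g : R * R -> V,
    {within closure U, continuous g} /\ (forall p, U p -> g p = f p).

(* C^2 up to the boundary of the open set [U]: the derivatives of order one and
   two, defined in [U], extend continuously to [closure U]. The values of [f]
   outside [closure U] are irrelevant. *)
Definition C2_closure (R : realType) (V : normedModType R) (U : set (R * R))
    (f : R * R -> V) : Prop :=
  [/\ C2_on U f,
      {within closure U, continuous f},
      (forall a, a = e1 \/ a = e2 -> extends_continuously U ('D_a f)) &
      (forall a b, a = e1 \/ a = e2 -> b = e1 \/ b = e2 ->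
         extends_continuously U ('D_b ('D_a f)))].

Definition homeomorphism_between (S T : topologicalType) (A : set S) (B : set T)
    (f : S -> T) : Prop :=
  [/\ (forall x, A x -> B (f x)), {within A, continuous f} &
      exists g : T -> S,
        [/\ (forall y, B y -> A (g y)), {within B, continuous g},
            (forall x, A x -> g (f x) = x) & (forall y, B y -> f (g y) = y)]].

(* (x, y) |-> (x, y, phi_0(x, y), ..., phi_(m-1)(x, y)) *)
Definition graph (R : realType) (m : nat) (phi : 'I_m -> R * R -> R)
    (p : R * R) : 'rV[R]_(2 + m) :=
  row_mx (\row_(i < 2) (if i == 0 then p.1 else p.2)) (\row_(s < m) phi s p).

(* First fundamental form: h_ij is [metric X e_i e_j]. *)
Definition metric (R : realType) (k : nat) (X : R * R -> 'rV[R]_k)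
    (a b p : R * R) : R :=
  dot ('D_a X p) ('D_b X p).

Definition area_element (R : realType) (k : nat) (X : R * R -> 'rV[R]_k)
    (p : R * R) : R :=
  Num.sqrt (metric X e1 e1 p * metric X e2 e2 p - metric X e1 e2 p ^+ 2).

(* Second fundamental form: L_{N,ij} is [second_form X N e_i e_j]. *)
Definition second_form (R : realType) (k : nat) (X N : R * R -> 'rV[R]_k)
    (a b p : R * R) : R :=
  dot ('D_b ('D_a X) p) (N p).

Definition unit_normal_field (R : realType) (k : nat) (U : set (R * R))
    (X N : R * R -> 'rV[R]_k) : Prop :=
  forall p, U p ->
    [/\ differentiable N p, enorm (N p) = 1,
        dot (N p) ('D_e1 X p) = 0 & dot (N p) ('D_e2 X p) = 0].

Definition mean_curvature (R : realType) (k : nat) (X N : R * R -> 'rV[R]_k)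
    (p : R * R) : R :=
  (second_form X N e1 e1 p * metric X e2 e2 p
   - 2 * second_form X N e1 e2 p * metric X e1 e2 p
   + second_form X N e2 e2 p * metric X e1 e1 p)
  / (2 * area_element X p ^+ 2).

Definition gauss_curvature (R : realType) (k : nat) (X N : R * R -> 'rV[R]_k)
    (p : R * R) : R :=
  (second_form X N e1 e1 p * second_form X N e2 e2 p
   - second_form X N e1 e2 p ^+ 2)
  / area_element X p ^+ 2.

(* The unordered pair {k1, k2} is determined by its sum and product. *)
Definition principal_curvatures (R : realType) (k : nat)
    (X N : R * R -> 'rV[R]_k) (p : R * R) (k1 k2 : R) : Prop :=
  mean_curvature X N p = (k1 + k2) / 2 /\ gauss_curvature X N p = k1 * k2.

Definition minimal (R : realType) (k : nat) (U : set (R * R))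
    (X : R * R -> 'rV[R]_k) : Prop :=
  forall N, unit_normal_field U X N ->
    forall p, U p -> mean_curvature X N p = 0.

Definition plane_map (R : realType) (m : nat) (X : R * R -> 'rV[R]_(2 + m))
    (p : R * R) : R * R :=
  (X p 0 0, X p 0 1).

Definition plane_jacobian (R : realType) (f : R * R -> R * R) (p : R * R) : R :=
  ('D_e1 f p).1 * ('D_e2 f p).2 - ('D_e2 f p).1 * ('D_e1 f p).2.

(* [X] is the graph of [phi] over the closed disc of radius [r] in conformal
   parameters on the closed unit disc. Positivity of the Jacobian already makes
   [X] an immersion. *)
Record conformal_parameters (R : realType) (m : nat) (r : R)
    (phi : 'I_m -> R * R -> R) (X : R * R -> 'rV[R]_(2 + m)) : Prop := {
  conf_C2 : C2_on (disc 1) X;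
  conf_C0 : {within closure (disc (1 : R)), continuous X};
  conf_graph : forall p, closure (disc 1) p -> X p = graph phi (plane_map X p);
  conf_maps : forall p, closure (disc 1) p -> closure (disc r) (plane_map X p);
  conf_inj : forall p q, closure (disc 1) p -> closure (disc 1) q ->
    plane_map X p = plane_map X q -> p = q;
  conf_jacobian : forall p, disc 1 p -> 0 < plane_jacobian (plane_map X) p;
  conf_origin : plane_map X (0, 0) = (0, 0);
  conf_boundary : homeomorphism_between (boundary (disc 1)) (boundary (disc r))
    (plane_map X);
  conf_conformal : forall p, disc 1 p ->
    [/\ enorm ('D_e1 X p) ^+ 2 = area_element X p,
        enorm ('D_e2 X p) ^+ 2 = area_element X p &
        dot ('D_e1 X p) ('D_e2 X p) = 0]
}.

(* A genuine supremum whenever [X] is continuous on the closed unit disc, the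
   set being then nonempty and bounded. *)
Definition C0_norm (R : realType) (k : nat) (X : R * R -> 'rV[R]_k) : R :=
  sup [set enorm (X p) | p in disc 1].

(* Main.v *)
Require Import Defs.
From HB Require Import structures.
From mathcomp Require Import all_boot all_order all_algebra.
From mathcomp Require Import all_classical all_reals all_analysis.
From mathcomp Require Import ring lra.
Import Order.TTheory GRing.Theory Num.Theory.
Import numFieldNormedType.Exports.
Set Implicit Arguments.
Unset Strict Implicit.
Unset Printing Implicit Defensive.
Local Open Scope classical_set_scope.
Local Open Scope ring_scope.

(* In conformal parameters a minimal graph is harmonic: the minimal surface system
   says that the Laplacian of [X] is tangent to the surface, and differentiating
   the conformality relations that it is normal. A barrier argument then bounds
   the second derivatives of [X . N] at the origin by [4 ||X||], so it remains to
   bound the area element from below by a multiple of [r^2].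

   This is Heinz' inequality for the harmonic map [F = (X_0, X_1)]. As [F] is a
   homeomorphism between the boundary circles, its first coordinate [f] changes sign
   at exactly two boundary points. If [l] is the affine function vanishing at these
   points, then [l f] has a constant sign on the circle, whereas its mean there is
   [b . grad f (0) / 2] with [b] the linear part of [l]. Hence
   [|grad f (0)| / 2 >= mean |l f|]; summing over both coordinates gives the bound,
   because [f1^2 + f2^2 = r^2] on the circle and [mean (l1^2 l2^2) >= 1/8].

   The means over the circle are replaced by means over the [2^m]-th roots of
   unity, so that no integration is needed. *)

(** * Harmonic functions and the maximum principle *)

(** Minimality is assumed in the graph variables, while the curvatures are those of [X]. Invariance
    of the mean curvature under reparametrization is bypassed: the minimal surface system is carried
    over to [X] by comparing second-order Taylor expansions of [phi s (plane_map X)].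

    Where the sign changes of [f1] and [f2] lie on the circle is unknown, so the lower bound must
    hold for all pairs of lines. The means of [|l1 f1|] and [|l2 f2|] are not computable, but as
    [|l_i| <= 2] and [f1^2 + f2^2 = r^2], their sum dominates [r / 8] times the mean of [l1^2 l2^2],
    a trigonometric polynomial of degree 4 that eight equally spaced points integrate exactly.

    Constants: that mean is at least [1/8], so [b . grad f1 + c . grad f2 >= r / 32] for unit
    vectors [b], [c], and the squared gradients add up to at least [r^2 / 2048]. They add up to at
    most [|X_u|^2 + |X_v|^2 = 2 W], whence [W >= r^2 / 4096]. With [d = X_uu . N] and [e = X_uv . N]
    at most [4 ||X||] in absolute value, the curvature sum [2 (d^2 + e^2) / W^2] is at most
    [64 ||X||^2 / W^2]. *)

Section Harmonic.
Variable R : realType.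
Implicit Types (f g : R * R -> R) (p h : R * R).

(* The values of [f] at the four points [p +- t h], [p +- i t h]. *)
Definition cross_sum f p h t : R :=
  f (p.1 + t * h.1, p.2 + t * h.2) + f (p.1 - t * h.1, p.2 - t * h.2) +
  f (p.1 - t * h.2, p.2 + t * h.1) + f (p.1 + t * h.2, p.2 - t * h.1) - 4 * f p.

(* A pointwise form of [Delta f = 0], which needs no derivatives and is visibly
   stable under similarities. *)
Definition harmonic_at f p := forall h e, 0 < e ->
  \forall t \near (0 : R)^'+, `|cross_sum f p h t| <= e * t ^+ 2.

Lemma harmonic_atD f g p : harmonic_at f p -> harmonic_at g p ->
  harmonic_at (fun q => f q + g q) p.
Proof.
move=> hf hg h e e0; have e2 : 0 < e / 2 by lra.
near=> t.
have A : `|cross_sum f p h t| <= e / 2 * t ^+ 2 by near: t; exact: hf.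
have B : `|cross_sum g p h t| <= e / 2 * t ^+ 2 by near: t; exact: hg.
have -> : cross_sum (fun q => f q + g q) p h t = cross_sum f p h t + cross_sum g p h t.
  by rewrite /cross_sum; ring.
by apply: le_trans (ler_normD _ _) _; lra.
Unshelve. all: by end_near. Qed.

Lemma harmonic_atZ f p k : harmonic_at f p -> harmonic_at (fun q => k * f q) p.
Proof.
move=> hf h e e0; have k0 : 0 < `|k| + 1 by rewrite ltr_wpDl.
near=> t.
have A : `|cross_sum f p h t| <= e / (`|k| + 1) * t ^+ 2.
  by near: t; apply: hf; rewrite divr_gt0.
have -> : cross_sum (fun q => k * f q) p h t = k * cross_sum f p h t.
  by rewrite /cross_sum; ring.
rewrite normrM; apply: le_trans (ler_wpM2l (normr_ge0 k) A) _.
rewrite mulrA ler_wpM2r ?sqr_ge0// mulrCA -[leRHS]mulr1 ler_wpM2l ?(ltW e0)//.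
by rewrite ler_pdivrMr// mul1r lerDl.
Unshelve. all: by end_near. Qed.

Lemma harmonic_atB f g p : harmonic_at f p -> harmonic_at g p ->
  harmonic_at (fun q => f q - g q) p.
Proof.
move=> hf hg; have := harmonic_atD hf (harmonic_atZ (-1) hg).
by congr harmonic_at; apply/funext => q; ring.
Qed.

Lemma harmonic_at_near f g p : (\near p, f p = g p) -> harmonic_at f p ->
  harmonic_at g p.
Proof.
move=> /nbhs_ballP[d /= d0 fg] hf h e e0.
have k0 : 0 < `|h.1| + `|h.2| + 1 by rewrite ltr_wpDl// addr_ge0.
near=> t.
have t0 : 0 < t by near: t; exact: nbhs_right_gt.
have tl : t * (`|h.1| + `|h.2|) < d.
  apply: (@le_lt_trans _ _ (t * (`|h.1| + `|h.2| + 1))).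
    by rewrite ler_wpM2l ?(ltW t0)// lerDl.
  rewrite -ltr_pdivlMr//; near: t; apply: nbhs_right_lt; exact: divr_gt0.
have b1 : t * `|h.1| < d.
  by apply: le_lt_trans tl; rewrite ler_wpM2l ?(ltW t0)// lerDl.
have b2 : t * `|h.2| < d.
  by apply: le_lt_trans tl; rewrite ler_wpM2l ?(ltW t0)// lerDr.
have E a b : `|a| < d -> `|b| < d -> f (p.1 + a, p.2 + b) = g (p.1 + a, p.2 + b).
  move=> ad bd; apply: fg; split; rewrite /ball/= opprD addrA subrr sub0r normrN//.
have n0 : `|t| = t by rewrite gtr0_norm.
have <- : cross_sum f p h t = cross_sum g p h t.
  rewrite /cross_sum !E ?normrN ?normrM ?n0//.
  by move: (E 0 0); rewrite !addr0 normr0 -surjective_pairing => ->.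
by near: t; exact: hf.
Unshelve. all: by end_near. Qed.

Lemma harmonic_at_cst k p : harmonic_at (fun=> k) p.
Proof.
move=> h e e0; near=> t; rewrite /cross_sum.
rewrite (_ : _ - _ = 0); last by ring.
by rewrite normr0 mulr_ge0 ?sqr_ge0 ?ltW.
Unshelve. all: by end_near. Qed.

Lemma harmonic_at_affine a b c p : harmonic_at (fun q => a * q.1 + b * q.2 + c) p.
Proof.
move=> h e e0; near=> t; rewrite /cross_sum/=.
rewrite (_ : _ - _ = 0); last by ring.
by rewrite normr0 mulr_ge0 ?sqr_ge0 ?ltW.
Unshelve. all: by end_near. Qed.

Lemma harmonic_at_quadratic p : harmonic_at (fun q => q.1 ^+ 2 - q.2 ^+ 2) p.
Proof.
move=> h e e0; near=> t; rewrite /cross_sum/=.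
rewrite (_ : _ - _ = 0); last by ring.
by rewrite normr0 mulr_ge0 ?sqr_ge0 ?ltW.
Unshelve. all: by end_near. Qed.

Definition re_pow4 (q : R * R) : R := q.1 ^+ 4 - 6 * q.1 ^+ 2 * q.2 ^+ 2 + q.2 ^+ 4.

(** The four increments [t h i^k] have the same fourth power, and the lower-order terms cancel, so
    the cross sum is exactly [4 t^4 Re h^4], which is [o(t^2)]. *)
Lemma harmonic_at_re_pow4 p : harmonic_at re_pow4 p.
Proof.
move=> h e e0; have k0 : 0 < `|4 * re_pow4 h| + 1 by rewrite ltr_wpDl.
near=> t.
have t0 : 0 < t by near: t; exact: nbhs_right_gt.
have -> : cross_sum re_pow4 p h t = 4 * re_pow4 h * t ^+ 4.
  by rewrite /cross_sum /re_pow4/=; ring.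
have tl : t < e / (`|4 * re_pow4 h| + 1).
  by near: t; apply: nbhs_right_lt; exact: divr_gt0.
have t1 : t < 1 by near: t; exact: nbhs_right_lt.
rewrite normrM (ger0_norm (exprn_ge0 4 (ltW t0))).
have -> : t ^+ 4 = t ^+ 2 * t ^+ 2 by ring.
rewrite mulrA ler_wpM2r ?sqr_ge0//.
move: tl; rewrite ltr_pdivlMr// => /ltW tl.
apply: le_trans tl; rewrite mulrC expr2 -mulrA ler_wpM2l ?(ltW t0)//.
have : 0 <= `|4 * re_pow4 h| by [].
set w := `|_|; nra.
Unshelve. all: by end_near. Qed.

(** The substitution is multiplication by [a - i b], followed by conjugation when [s = -1]. It maps
    crosses to crosses; conjugation only exchanges the last two points. *)
Lemma harmonic_at_conformal f (a b s : R) p : s = 1 \/ s = -1 ->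
  harmonic_at f (a * p.1 + b * p.2, s * (a * p.2 - b * p.1)) ->
  harmonic_at (fun q => f (a * q.1 + b * q.2, s * (a * q.2 - b * q.1))) p.
Proof.
move=> s1 hf h e e0.
have := hf (a * h.1 + b * h.2, s * (a * h.2 - b * h.1)) e e0.
apply: filterS => t; rewrite /cross_sum/=; congr (`|_| <= _).
case: s1 => ->.
- congr (f (_, _) + f (_, _) + f (_, _) + f (_, _) - _); ring.
- rewrite -!addrA; congr (f (_, _) + _); try ring.
  congr (f (_, _) + _); try ring.
  rewrite addrCA; congr (f (_, _) + (f (_, _) + _)); ring.
Qed.

(** The perturbation [e |p|^2] has cross sum [4 e t^2] along the axes. At an interior maximum of
    [f + e |p|^2] the total cross sum is at most 0, whereas that of [f] is at least [- e t^2] for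
    some small [t]. *)
Theorem maximum_principle (K U : set (R * R)) f :
  compact K -> {within K, continuous f} -> open U -> U `<=` K ->
  (forall p, U p -> harmonic_at f p) ->
  (forall p, K p -> ~ U p -> f p <= 0) ->
  forall p, K p -> f p <= 0.
Proof.
move=> cK cf oU UK hf fb p0 Kp0; rewrite leNgt; apply/negP => m0.
pose s (p : R * R) : R := p.1 ^+ 2 + p.2 ^+ 2.
have cs : continuous s.
  move=> p; apply: cvgD; rewrite /s; (under eq_fun do rewrite expr2);
    apply: cvgM; (exact: cvg_fst || exact: cvg_snd).
have [q Kq sq] := compact_EVT_max (ex_intro _ _ Kp0) cK (continuous_subspaceT cs).
have s0 p : 0 <= s p by rewrite addr_ge0 ?sqr_ge0.
(* With this [e] the perturbation stays below [f p0 / 2] on [K], so [f] is still positive at a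
   maximum of the perturbed function, which therefore lies in [U]. *)
pose e := f p0 / (s q + 1) / 2.
have q0 : 0 < s q + 1 by rewrite ltr_wpDl.
have e0 : 0 < e by rewrite !divr_gt0.
have eE : e * (s q + 1) = f p0 / 2 by rewrite /e; field; lra.
have cg : {within K, continuous (fun p => f p + e * s p)}.
  move=> p; apply: cvgD; first exact: cf.
  apply: cvgM; first exact: cvg_cst.
  by have := continuous_subspaceT cs; apply.
have [z Kz zmax] := compact_EVT_max (ex_intro _ _ Kp0) cK cg.
have fz : f p0 <= f z + e * s z.
  have := zmax p0 (mem_set Kp0); have := s0 p0; nra.
have esz : e * s z <= f p0 / 2 by have := sq z Kz; nra.
have Uz : U z.
  apply: contrapT => nU; have := fb z (set_mem Kz) nU; lra.
have zK : nbhs z K by apply: filterS UK _; exact: open_nbhs_nbhs.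
have /nbhs_ballP[d /= d0 dK] := zK.
have [t [t0 td tc]] : exists t : R, [/\ 0 < t, t < d & `|cross_sum f z (1, 0) t| <= e * t ^+ 2].
  have := hf z Uz (1, 0) e e0 => near_t.
  have [t Ht] : exists t : R, 0 < t /\ t < d /\ `|cross_sum f z (1, 0) t| <= e * t ^+ 2.
    apply: (@filter_ex _ (0:R)^'+); near=> t; split; [|split].
    - by near: t; exact: nbhs_right_gt.
    - by near: t; exact: nbhs_right_lt.
    - by near: t.
  by exists t; case: Ht => ? [].
have Kz' a b : `|a| < d -> `|b| < d -> f (z.1 + a, z.2 + b) + e * s (z.1 + a, z.2 + b) <= f z + e * s z.
  move=> ad bd; apply: zmax; apply/mem_set/dK.
  by split; rewrite /ball/= opprD addrA subrr sub0r normrN.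
have nt : `|t| < d by rewrite gtr0_norm.
have nt' : `|- t| < d by rewrite normrN.
have n0 : `|0 : R| < d by rewrite normr0.
move: (Kz' t 0 nt n0) (Kz' (- t) 0 nt' n0) (Kz' 0 t n0 nt) (Kz' 0 (- t) n0 nt').
move: tc; rewrite /cross_sum/= !mulr1 !mulr0 !subr0 !addr0.
rewrite /s/= ler_norml => /andP[+ _].
set f1 := f (_, _); set f2 := f (_, _); set f3 := f (_, _); set f4 := f (_, _).
have : 0 < e * t ^+ 2 by rewrite mulr_gt0 ?exprn_gt0.
lra.
Unshelve. all: by end_near. Qed.

End Harmonic.

(** * Continuity of polynomial expressions *)

Lemma cvg_exprn (R : realType) (T : Type) (F : set_system T) (FF : Filter F)
    (f : T -> R) (a : R) (n : nat) :
  f @ F --> a -> (fun x => f x ^+ n) @ F --> a ^+ n.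
Proof. by move=> fa; exact: (@cvg_comp _ _ _ f (fun y => y ^+ n) _ _ _ fa (@exprn_continuous R n a)). Qed.

Lemma continuous_pair (T U V : topologicalType) (f : T -> U) (g : T -> V) :
  continuous f -> continuous g -> continuous (fun x => (f x, g x)).
Proof. by move=> cf cg x; exact: (cvg_pair (cf x) (cg x)). Qed.

Section RealContinuity.
Variables (R : realType) (T : topologicalType).
Implicit Types f g : T -> R.

Lemma continuous_add f g : continuous f -> continuous g ->
  continuous (fun x => f x + g x).
Proof. by move=> cf cg x; apply: cvgD; [exact: cf|exact: cg]. Qed.

Lemma continuous_opp f : continuous f -> continuous (fun x => - f x).
Proof. by move=> cf x; apply: cvgN; exact: cf. Qed.

Lemma continuous_mul f g : continuous f -> continuous g ->
  continuous (fun x => f x * g x).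
Proof. by move=> cf cg x; apply: cvgM; [exact: cf|exact: cg]. Qed.

Lemma continuous_expr f n : continuous f -> continuous (fun x => f x ^+ n).
Proof. by move=> cf x; apply: cvg_exprn; exact: cf. Qed.

Lemma continuous_abs f : continuous f -> continuous (fun x => `|f x|).
Proof. by move=> cf x; apply: cvg_norm; exact: cf. Qed.

Lemma continuous_cst (k : R) : continuous (fun _ : T => k).
Proof. exact: cst_continuous. Qed.

End RealContinuity.

Ltac continuity := lazymatch goal with
  | |- continuous (fun x => @?a x + @?b x) => apply: (@continuous_add _ _ a b); continuity
  | |- continuous (fun x => - @?a x) => apply: (@continuous_opp _ _ a); continuity
  | |- continuous (fun x => @?a x * @?b x) => apply: (@continuous_mul _ _ a b); continuity
  | |- continuous (fun x => @?a x ^+ _) => apply: (@continuous_expr _ _ a); continuity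
  | |- continuous (fun x => `|@?a x|) => apply: (@continuous_abs _ _ a); continuity
  | |- continuous (fun x => (@?a x, @?b x)) => apply: (@continuous_pair _ _ _ a b); continuity
  | |- continuous (fun x => x.1) => move=> ?; exact: cvg_fst
  | |- continuous (fun x => x.2) => move=> ?; exact: cvg_snd
  | |- continuous (fun x => x) => move=> ?; exact: cvg_id
  | |- continuous (fun _ => _) => try (exact: continuous_cst)
  | |- _ => idtac end.

(** * Barrier estimates for harmonic functions on the unit disc *)

Section InteriorEstimates.
Variable R : realType.
Implicit Types (f g : R * R -> R) (p q : R * R).

Definition sqn p : R := p.1 ^+ 2 + p.2 ^+ 2.

Lemma sqn_ge0 p : 0 <= sqn p.
Proof. by rewrite addr_ge0 ?sqr_ge0. Qed.

Lemma continuous_sqn : continuous sqn.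
Proof. by rewrite /sqn; continuity. Qed.

Definition cdisc : set (R * R) := [set p | sqn p <= 1].

Lemma closed_cdisc : closed cdisc.
Proof.
apply: (@closed_comp _ _ sqn [set x | x <= 1]); last exact: closed_le.
by move=> p _; exact: continuous_sqn.
Qed.

Lemma compact_cdisc : compact cdisc.
Proof.
apply: (subclosed_compact closed_cdisc (compact_setX (@segment_compact R (-1) 1)
  (@segment_compact R (-1) 1))).
move=> p; rewrite /cdisc /sqn /= !in_itv/= => H.
by split; apply/andP; split; nra.
Qed.

(** The form in which barriers are applied: the sign of [g] cuts a half disc or a quarter disc out
    of the unit disc, and the boundary consists of an arc and of points where [g] vanishes. *)
Lemma maximum_principle_cut (g f : R * R -> R) : continuous g -> continuous f ->
  (forall p, sqn p < 1 -> 0 < g p -> harmonic_at f p) ->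
  (forall p, sqn p = 1 -> 0 <= g p -> f p <= 0) ->
  (forall p, sqn p <= 1 -> g p = 0 -> f p <= 0) ->
  forall p, sqn p <= 1 -> 0 <= g p -> f p <= 0.
Proof.
move=> cg cf hf f1 f0 p p1 gp.
have cK : compact (cdisc `&` [set p | 0 <= g p]).
  apply: (subclosed_compact _ compact_cdisc); last by apply: subIsetl.
  apply: closedI; first exact: closed_cdisc.
  apply: (@closed_comp _ _ g [set x | 0 <= x]); last exact: closed_ge.
  by move=> q _; exact: cg.
apply: (@maximum_principle _ _ ([set q | sqn q < 1] `&` [set q | 0 < g q]) f cK) => //.
- exact: continuous_subspaceT.
- apply: openI.
    apply: (@open_comp _ _ sqn [set x | x < 1]); last exact: open_lt.
    by move=> q _; exact: continuous_sqn.
  apply: (@open_comp _ _ g [set x | 0 < x]); last exact: open_gt.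
  by move=> q _; exact: cg.
- by move=> q [/= /ltW q1 /ltW q2]; split.
- by move=> q [q1 q2]; exact: hf.
- move=> q [/=]; rewrite /cdisc/= => q1 q2 nq.
  have [q1'|q1'] := eqVneq (sqn q) 1; first exact: f1.
  have [q2'|q2'] := eqVneq (g q) 0; first exact: f0.
  by case: nq; split => /=; rewrite lt_neqAle ?q1' ?q1// eq_sym q2' q2.
Qed.

Lemma maximum_principle_disc f : continuous f ->
  (forall p, sqn p < 1 -> harmonic_at f p) ->
  (forall p, sqn p = 1 -> f p <= 0) ->
  forall p, sqn p <= 1 -> f p <= 0.
Proof.
move=> cf hf f1 p p1.
apply: (@maximum_principle_cut (fun=> 1) f) => //.
- exact: cst_continuous.
- by move=> q q1 _; exact: hf.
- by move=> q q1 _; exact: f1.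
- by move=> q _ /eqP; rewrite oner_eq0.
Qed.

Lemma harmonic_at_isometry f (a b s : R) g p : s = 1 \/ s = -1 ->
  (forall q, g q = f (a * q.1 + b * q.2, s * (a * q.2 - b * q.1))) ->
  harmonic_at f (a * p.1 + b * p.2, s * (a * p.2 - b * p.1)) ->
  harmonic_at g p.
Proof.
by move=> s1 gE /(harmonic_at_conformal s1); congr harmonic_at; apply/funext.
Qed.

Variables (f : R * R -> R) (M : R).
Hypothesis cf : continuous f.
Hypothesis hf : forall p, sqn p < 1 -> harmonic_at f p.
Hypothesis fM : forall p, sqn p <= 1 -> `|f p| <= M.

Let M0 : 0 <= M.
Proof. by apply: le_trans (fM (p := (0, 0)) _); rewrite ?normr_ge0// /sqn/=; lra. Qed.

Let fl p : sqn p <= 1 -> f p <= M.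
Proof. by move=> /fM; rewrite ler_norml => /andP[]. Qed.

Let fg p : sqn p <= 1 -> - M <= f p.
Proof. by move=> /fM; rewrite ler_norml => /andP[]. Qed.

(* Barrier on the half disc [0 <= u]: the odd part in [u] is at most
   [2 M (2 u - u^2 + v^2)]. *)
Lemma harmonic_odd_difference x : 0 <= x <= 1 -> f (x, 0) - f (- x, 0) <= 4 * M * x.
Proof.
move=> /andP[x0 x1].
pose g (q : R * R) := f q - f (- q.1, q.2) + 2 * M * (q.1 ^+ 2 - q.2 ^+ 2)
  - (4 * M * q.1 + 0 * q.2 + 0).
have cr : continuous (fun q : R * R => (- q.1, q.2)).
  by continuity.
have cg : continuous g.
  rewrite /g; continuity; first exact: cf.
  by move=> q; apply: (@continuous_comp _ _ _ _ f); [exact: cr|exact: cf].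
have : g (x, 0) <= 0.
  apply: (@maximum_principle_cut (fun q => q.1) g) => //=.
  - by continuity.
  - move=> q q1 q0; apply: harmonic_atB; last exact: harmonic_at_affine.
    apply: harmonic_atD; last exact/harmonic_atZ/harmonic_at_quadratic.
    apply: harmonic_atB; first exact: hf.
    apply: (@harmonic_at_isometry f (-1) 0 (-1)); first by right.
      by move=> r; congr (f (_, _)); ring.
    by apply: hf; apply: le_lt_trans q1; rewrite /sqn/=; lra.
  (* On the arc the odd part is at most [2 M], which leaves [- 4 M u (1 - u)]. *)
  - move=> q q1 q0; rewrite /g.
    have A : f q <= M by apply: fl; rewrite q1.
    have B : - M <= f (- q.1, q.2) by apply: fg; rewrite /sqn/= sqrrN -/(sqn q) q1.
    have -> : q.1 ^+ 2 - q.2 ^+ 2 = 2 * q.1 ^+ 2 - 1 by move: q1; rewrite /sqn; lra.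
    have : q.1 <= 1 by move: q1; rewrite /sqn; nra.
    move=> q1'; have : 0 <= M * (q.1 * (1 - q.1)) by rewrite !mulr_ge0// subr_ge0.
    by lra.
  - move=> [u v]/= q1 u0; rewrite /g/= u0 oppr0.
    have : 0 <= M * v ^+ 2 by rewrite mulr_ge0 ?sqr_ge0.
    by lra.
  - by rewrite /sqn/=; nra.
rewrite /g/=; have : 0 <= M * x ^+ 2 by rewrite mulr_ge0 ?sqr_ge0.
lra.
Qed.

(* Barrier on the quarter disc [|v| <= u]: [4 M (2 Re z^2 - Re z^4)]. *)
Lemma harmonic_second_difference x : 0 <= x <= 1 ->
  f (x, 0) + f (- x, 0) - f (0, x) - f (0, - x) <= 8 * M * x ^+ 2.
Proof.
move=> /andP[x0 x1].
pose g (q : R * R) := f q + f (- q.1, - q.2) - f (q.2, q.1) - f (- q.2, - q.1)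
  - 8 * M * (q.1 ^+ 2 - q.2 ^+ 2) + 4 * M * re_pow4 q.
have cg : continuous g.
  have cr (a b c d : R) : continuous (fun q : R * R => f (a * q.1 + b * q.2, c * q.1 + d * q.2)).
    have cl : continuous (fun q : R * R => (a * q.1 + b * q.2, c * q.1 + d * q.2)).
      by continuity.
    by move=> q; apply: (@continuous_comp _ _ _ _ f); [exact: cl|exact: cf].
  have -> : g = fun q => f (1 * q.1 + 0 * q.2, 0 * q.1 + 1 * q.2)
      + f ((-1) * q.1 + 0 * q.2, 0 * q.1 + (-1) * q.2)
      - f (0 * q.1 + 1 * q.2, 1 * q.1 + 0 * q.2)
      - f (0 * q.1 + (-1) * q.2, (-1) * q.1 + 0 * q.2)
      - 8 * M * (q.1 ^+ 2 - q.2 ^+ 2) + 4 * M * re_pow4 q.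
    by apply/funext => -[u v]; rewrite /g/= !mul0r !mul1r !mulN1r !addr0 !add0r.
  by rewrite /re_pow4; continuity; exact: cr.
have : g (x, 0) <= 0.
  apply: (@maximum_principle_cut (fun q => q.1 - `|q.2|) g) => //=.
  - by continuity.
  - move=> q q1 q0; apply: harmonic_atD; last exact/harmonic_atZ/harmonic_at_re_pow4.
    apply: harmonic_atB; last exact/harmonic_atZ/harmonic_at_quadratic.
    apply: harmonic_atB; first apply: harmonic_atB; first apply: harmonic_atD.
    + exact: hf.
    + apply: (@harmonic_at_isometry f (-1) 0 1); first by left.
        by move=> r; congr (f (_, _)); ring.
      by apply: hf; apply: le_lt_trans q1; rewrite /sqn/=; lra.
    + apply: (@harmonic_at_isometry f 0 1 (-1)); first by right.
        by move=> r; congr (f (_, _)); ring.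
      by apply: hf; apply: le_lt_trans q1; rewrite /sqn/=; lra.
    + apply: (@harmonic_at_isometry f 0 (-1) (-1)); first by right.
        by move=> r; congr (f (_, _)); ring.
      by apply: hf; apply: le_lt_trans q1; rewrite /sqn/=; lra.
  - move=> [u v]/= q1 q0; rewrite /g/=.
    have A := fl (p := (u, v)); have B := fl (p := (- u, - v)).
    have C := fg (p := (v, u)); have D := fg (p := (- v, - u)).
    move: A B C D; rewrite /sqn/= !sqrrN [v ^+ 2 + _]addrC.
    move: q1; rewrite /sqn/= => q1; rewrite q1 => /(_ (lexx _)) A /(_ (lexx _)) B /(_ (lexx _)) C /(_ (lexx _)) D.
    have -> : re_pow4 (u, v) = 8 * (u ^+ 2) ^+ 2 - 8 * u ^+ 2 + 1.
      rewrite /re_pow4/= (_ : v ^+ 2 = 1 - u ^+ 2); last by rewrite -q1; ring.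
      rewrite (_ : v ^+ 4 = (v ^+ 2) ^+ 2); last by ring.
      by rewrite (_ : v ^+ 2 = 1 - u ^+ 2); [ring|rewrite -q1; ring].
    rewrite (_ : v ^+ 2 = 1 - u ^+ 2); last by rewrite -q1; ring.
    have u1 : u ^+ 2 <= 1 by have := sqr_ge0 v; lra.
    have u2 : 1 <= 2 * u ^+ 2.
      have : v ^+ 2 <= u ^+ 2.
        by rewrite -(real_normK (num_real v)) ler_sqr ?nnegrE//; [lra|have := normr_ge0 v; lra].
      by lra.
    (* On the arc the four values of [f] contribute at most [4 M], and the total is then at most
       [- 16 M (2 u^2 - 1) (1 - u^2)]. *)
    have : 0 <= M * ((2 * u ^+ 2 - 1) * (1 - u ^+ 2)).
      by rewrite !mulr_ge0// subr_ge0.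
    by lra.
  - move=> [u v]/= q1 q0; rewrite /g/= /re_pow4/=.
    (* On the diagonals the four values of [f] cancel in pairs, and [Re z^4 = - 4 v^4] has the right
       sign. *)
    have uv : u = v \/ u = - v.
      have : u = `|v| by lra.
      by case: (lerP 0 v) => v0; rewrite ?(ger0_norm v0) ?(ltr0_norm v0); [left|right].
    case: uv => ->; rewrite ?opprK.
      have : 0 <= M * (v ^+ 2) ^+ 2 by rewrite mulr_ge0 ?sqr_ge0.
      by nra.
    have : 0 <= M * (v ^+ 2) ^+ 2 by rewrite mulr_ge0 ?sqr_ge0.
    by nra.
  - by rewrite /sqn/=; nra.
  - by rewrite normr0 subr0.
rewrite /g/= /re_pow4/= oppr0; have : 0 <= M * (x ^+ 2) ^+ 2 by rewrite mulr_ge0 ?sqr_ge0.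
nra.
Qed.

End InteriorEstimates.

(** * Rotational averages *)

Section Averages.
Variable R : realType.
Implicit Types (f g : R -> R) (s t x y : R) (m n : nat).

(* The mean of [g] over [t] plus the multiples of [2 pi / 2 ^ m]. *)
Fixpoint avg m g t : R :=
  if m is n.+1 then (avg n g t + avg n g (t + pi / 2 ^+ n)) / 2 else g t.

Lemma eq_avg m f g t : f =1 g -> avg m f t = avg m g t.
Proof. by move=> fg; rewrite (_ : f = g)//; exact/funext. Qed.

Lemma avg_le m f g t : (forall x, f x <= g x) -> avg m f t <= avg m g t.
Proof.
move=> fg; elim: m t => [|m IH] t //=.
by have := IH t; have := IH (t + pi / 2 ^+ m); lra.
Qed.

Lemma avgD m f g t : avg m (fun x => f x + g x) t = avg m f t + avg m g t.
Proof. by elim: m t => [|m IH] t //=; rewrite !IH; field. Qed.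

Lemma avgZ m k f t : avg m (fun x => k * f x) t = k * avg m f t.
Proof. by elim: m t => [|m IH] t //=; rewrite !IH; field. Qed.

Lemma avg_cst m k t : avg m (fun=> k) t = k.
Proof. by elim: m t => [|m IH] t //=; rewrite !IH; field. Qed.

Lemma avg_shift m g s t : avg m (fun x => g (x + s)) t = avg m g (t + s).
Proof. by elim: m t => [|m IH] t //=; rewrite !IH addrAC. Qed.

(** A shift by one step permutes the sample points: it moves the first half of them to the second,
    and the second to the first half shifted by a full step of the coarser mean, to which induction
    applies. *)
Lemma avg_periodic m g t : (forall x, g (x + 2 * pi) = g x) ->
  avg m g (t + 2 * pi / 2 ^+ m) = avg m g t.
Proof.
move=> gp; elim: m t => [|m IH] t /=; first by rewrite expr0 divr1 gp.
have E2 : 2 ^+ m != 0 :> R by rewrite expf_neq0.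
have -> : 2 * pi / 2 ^+ m.+1 = pi / 2 ^+ m :> R by rewrite exprS; field; rewrite E2.
rewrite [X in _ + X](_ : _ = avg m g t); first by rewrite addrC.
by rewrite -[RHS]IH; congr (avg _ _ _); field.
Qed.

Lemma avg_dist m f g t e : (forall x, `|f x - g x| <= e) ->
  `|avg m f t - avg m g t| <= e.
Proof.
move=> fg; have H h : (forall x, h x <= e) -> avg m h t <= e.
  by move=> he; rewrite -[leRHS](avg_cst m e t); exact: avg_le.
have B u v : avg m u t - avg m v t = avg m (fun x => u x - v x) t.
  rewrite (@eq_avg m (fun x => u x - v x) (fun x => u x + -1 * v x)); last by move=> x; rewrite mulN1r.
  by rewrite avgD avgZ mulN1r.
rewrite ler_norml lerNl opprB !B; apply/andP; split; apply: H => x.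
- by apply: le_trans (fg x); rewrite distrC ler_norm.
- by apply: le_trans (fg x); rewrite ler_norm.
Qed.

(** A finer mean averages two coarser ones, so a mean that is independent of the starting point is
    already exact. *)
Lemma avg_stable n m g c : (forall t, avg n g t = c) -> (n <= m)%N ->
  forall t, avg m g t = c.
Proof.
move=> gc; elim: m => [|m IH].
  by rewrite leqn0 => /eqP n0 t; rewrite -(gc t) n0.
rewrite leq_eqVlt => /orP[/eqP <-//|]; rewrite ltnS => /IH {}IH t /=.
by rewrite !IH; field.
Qed.

Lemma periodic_intmul g (T : R) : (forall x, g (x + T) = g x) ->
  forall (k : int) x, g (x + k%:~R * T) = g x.
Proof.
move=> gT; have N n x : g (x + n%:R * T) = g x.
  elim: n x => [|n IH] x; first by rewrite mul0r addr0.
  by rewrite -[RHS]IH -[RHS]gT; congr g; rewrite -natr1; ring.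
case=> n x; first exact: N.
rewrite NegzE mulrNz mulNr -[LHS](N n.+1); congr g.
by rewrite -addrA addNr addr0.
Qed.

Lemma periodic_reduce g (T : R) : 0 < T -> (forall x, g (x + T) = g x) ->
  forall x, exists2 x', 0 <= x' < T & forall y, g (x + y) = g (x' + y).
Proof.
move=> T0 gT x; exists (x - (Num.floor (x / T))%:~R * T).
  have := floor_itv (x / T); rewrite intrD => /andP[A B].
  move: A B; rewrite ler_pdivlMr// ltr_pdivrMr// => A B.
  by apply/andP; split; lra.
move=> y; rewrite -[RHS](periodic_intmul gT (Num.floor (x / T))).
by congr g; ring.
Qed.

(** Uniform continuity on one period by compactness; periodicity carries it to the whole line. *)
Lemma periodic_uniform g (T e : R) : 0 < T -> (forall x, g (x + T) = g x) ->
  continuous g -> 0 < e ->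
  exists2 d, 0 < d & forall x y, `|y| < d -> `|g (x + y) - g x| <= e.
Proof.
move=> T0 gT cg e0.
have cK := @segment_compact R 0 T.
have /(compact_near_coveringP _).1/(_ _ (nbhs (0 : R)) (fun y x => `|g (x + y) - g x| <= e)) := cK.
have NF : Filter (nbhs (0 : R)) by exact: nbhs_filter.
move=> /(_ NF)[].
  move=> x _; have e2 : 0 < e / 2 by lra.
  have /(@cvgrPdist_le _ _ _ (nbhs x)) := cg x; move=> /(_ _ e2).
  move=> /nbhs_ballP[d /= d0 dP].
  have d2 : 0 < d / 2 by lra.
  exists (ball x (d / 2), ball (0 : R) (d / 2)) => /=.
    by split; exact: nbhsx_ballx.
  move=> [x' y]/= [xx' yy'].
  move: xx' yy'; rewrite /ball/= sub0r normrN => xx' yy'.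
  have A : `|g x - g x'| <= e / 2 by apply: dP; rewrite /ball/=; lra.
  have B : `|g x - g (x' + y)| <= e / 2.
    apply: dP; rewrite /ball/= opprD addrA; apply: le_lt_trans (ler_normB _ _) _.
    lra.
  rewrite (_ : _ - _ = (g x - g x') - (g x - g (x' + y))); last by ring.
  by apply: le_trans (ler_normB _ _) _; lra.
move=> d /= d0 dP; exists d => // x y yd.
have [x' /andP[x0 xT] E] := periodic_reduce T0 gT x.
have := E 0; rewrite !addr0 => ->; rewrite E.
by apply: (dP y); rewrite /ball/= ?sub0r ?normrN// in_itv/= x0 ltW.
Qed.

(** This replaces convergence to the integral: only near independence of the starting point is used
    later. By [avg_periodic] the starting point can be reduced to [[0, 2 pi / 2^m)], a range shorter
    than the modulus of continuity of [g]. *)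
Lemma avg_equidistribution g e : (forall x, g (x + 2 * pi) = g x) ->
  continuous g -> 0 < e ->
  exists m0, forall m, (m0 <= m)%N -> forall s, `|avg m g s - avg m g 0| <= e.
Proof.
move=> gp cg e0; have T0 : 0 < 2 * pi :> R by rewrite mulr_gt0// pi_gt0.
have [d d0 dP] := periodic_uniform T0 gp cg e0.
have [m0 m0P] : exists m0, forall m, (m0 <= m)%N -> 2 * pi / 2 ^+ m < d.
  have [n nP] : exists n : nat, 2 * pi / d < n%:R.
    by exists (Num.bound (2 * pi / d)); apply: archi_boundP; rewrite divr_ge0// ltW.
  exists n => m nm; rewrite ltr_pdivrMr ?exprn_gt0// [d * _]mulrC -ltr_pdivrMr//.
  apply: lt_le_trans nP _; rewrite -natrX ler_nat.
  by apply: leq_trans nm _; exact/ltnW/ltn_expl.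
exists m0 => m /m0P md s.
have Tm : 0 < 2 * pi / 2 ^+ m :> R by rewrite divr_gt0// exprn_gt0.
have [s' /andP[s0 sT] E] := periodic_reduce Tm (fun t => avg_periodic m t gp) s.
rewrite -[s]addr0 E addr0 -[s']add0r -avg_shift.
by apply: avg_dist => x; apply: dP; rewrite ger0_norm//; exact: lt_trans md.
Qed.

Lemma circle_param (p : R * R) : sqn p = 1 -> exists s, p = (cos s, sin s).
Proof.
case: p => u v; rewrite /sqn/= => uv.
have u1 : -1 <= u <= 1 by apply/andP; split; nra.
have cu : cos (acos u) = u by apply: acosK; rewrite in_itv.
have su : sin (acos u) = `|v|.
  by rewrite sin_acos// -uv addrAC subrr add0r sqrtr_sqr.
have [v0|v0] := lerP 0 v.
- by exists (acos u); rewrite cu su ger0_norm.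
- by exists (- acos u); rewrite cosN sinN cu su ltr0_norm// opprK.
Qed.

Lemma sin_pi4 : sin (pi / 4) = cos (pi / 4) :> R.
Proof.
rewrite -sinDpihalf (_ : pi / 4 + pi / 2 = pi - pi / 4); last by field.
by rewrite sinB sinpi cospi mul0r sub0r mulN1r opprK.
Qed.

Lemma cosD_pi4 t : cos (t + pi / 4) = cos (pi / 4) * (cos t - sin t) :> R.
Proof. by rewrite cosD sin_pi4; ring.
Qed.

Lemma sinD_pi4 t : sin (t + pi / 4) = cos (pi / 4) * (cos t + sin t) :> R.
Proof. by rewrite sinD sin_pi4; ring.
Qed.

Lemma cos_pi4_sqr : cos (pi / 4) ^+ 2 = 1 / 2 :> R.
Proof. by have := cos2Dsin2 (pi / 4 : R); rewrite sin_pi4; lra. Qed.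

(** [S] sums over quarter turns; the eight points are two such orbits, an eighth of a turn apart.
    Four points would not do for the degree 4 integrand of [avg_fourth_moment_ge], since [cos (4 t)]
    does not average to 0 over them. *)
Lemma avg3E (P : R -> R -> R) t :
  let c := cos t in let s := sin t in let q := cos (pi / 4) in
  let S x y := P x y + P (- x) (- y) + P (- y) x + P y (- x) in
  avg 3 (fun t => P (cos t) (sin t)) t = (S c s + S (q * (c - s)) (q * (c + s))) / 8.
Proof.
move=> c s q S.
have cp x : cos (x + pi / 1) = - cos x :> R by rewrite divr1 cosDpi.
have sp x : sin (x + pi / 1) = - sin x :> R by rewrite divr1 sinDpi.
have E4 : (2 ^+ 2 : R) = 4 by ring.
rewrite /= expr0 expr1 E4 !cp !sp !(cosDpihalf, sinDpihalf) !(cosD_pi4, sinD_pi4).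
rewrite /S -/c -/s -/q !opprK.
set a := q * _; set b := q * _.
by field.
Qed.

Lemma avg_first_moment (b1 b2 d p q : R) m t : (3 <= m)%N ->
  avg m (fun t => (b1 * cos t + b2 * sin t - d) * (p * cos t + q * sin t)) t =
  (b1 * p + b2 * q) / 2.
Proof.
move=> m3; apply: (avg_stable _ m3) => {}t.
rewrite (avg3E (fun x y => (b1 * x + b2 * y - d) * (p * x + q * y))) /=.
have := cos2Dsin2 t; have := cos_pi4_sqr.
set c := cos t; set s := sin t; set r := cos (pi / 4) => r2 cs.
have -> : (b1 * p + b2 * q) / 2 = (b1 * p + b2 * q) * (4 * (c ^+ 2 + s ^+ 2)) / 8.
  by rewrite cs; field.
set rhs := RHS; rewrite [LHS](_ : _ = (2 * (b1 * p + b2 * q) * (c ^+ 2 + s ^+ 2) +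
   r ^+ 2 * (4 * (b1 * p + b2 * q) * (c ^+ 2 + s ^+ 2))) / 8); last by field.
by rewrite r2 /rhs; field.
Qed.

(* Writing [cos (delta)] for the inner product of the two unit vectors, the mean
   equals [1/4 + cos (2 delta) / 8 + (d^2 + e^2) / 2 + 2 d e cos delta + d^2 e^2]. *)
Lemma avg_fourth_moment_ge (a1 a2 d b1 b2 e : R) m t : (3 <= m)%N ->
  a1 ^+ 2 + a2 ^+ 2 = 1 -> b1 ^+ 2 + b2 ^+ 2 = 1 ->
  1 / 8 <= avg m (fun t => (a1 * cos t + a2 * sin t - d) ^+ 2
                          * (b1 * cos t + b2 * sin t - e) ^+ 2) t.
Proof.
move=> m3 a b.
set k := a1 * b1 + a2 * b2.
rewrite (avg_stable (n := 3) (c := 1 / 8 + k ^+ 2 / 4 + (d ^+ 2 + e ^+ 2) / 2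
   + 2 * (d * e) * k + (d * e) ^+ 2))//; last first.
  move=> {}t.
  rewrite (avg3E (fun x y => (a1 * x + a2 * y - d) ^+ 2 * (b1 * x + b2 * y - e) ^+ 2)) /=.
  have := cos2Dsin2 t; have := cos_pi4_sqr.
  set c := cos t; set s := sin t; set r := cos (pi / 4) => r2 cs.
  (* These are the coordinates of the two unit vectors in the frame rotated by [t]. The eight-point
     sum depends only on their lengths and their inner product, so [t] drops out. *)
  pose x := a1 * c + a2 * s; pose x' := a2 * c - a1 * s.
  pose y := b1 * c + b2 * s; pose y' := b2 * c - b1 * s.
  have xE : x ^+ 2 + x' ^+ 2 = 1 by rewrite -[RHS]mulr1 -{1}a -cs /x /x'; ring.
  have yE : y ^+ 2 + y' ^+ 2 = 1 by rewrite -[RHS]mulr1 -{1}b -cs /y /y'; ring.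
  have kE : x * y + x' * y' = k by rewrite -[RHS]mulr1 -cs /x /x' /y /y' /k; ring.
  set lhs := LHS.
  have -> : lhs = (2 * (x ^+ 2 * y ^+ 2 + x' ^+ 2 * y' ^+ 2)
      + 2 * e ^+ 2 * (x ^+ 2 + x' ^+ 2) + 2 * d ^+ 2 * (y ^+ 2 + y' ^+ 2)
      + 8 * (d * e) * (x * y + x' * y') + 8 * (d * e) ^+ 2
      + r ^+ 2 * (r ^+ 2 * (4 * (x ^+ 2 + x' ^+ 2) * (y ^+ 2 + y' ^+ 2)
                            + 16 * (x * y * x' * y'))
        + 4 * e ^+ 2 * (x ^+ 2 + x' ^+ 2) + 4 * d ^+ 2 * (y ^+ 2 + y' ^+ 2)
        + 16 * (d * e) * (x * y + x' * y'))) / 8.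
    by rewrite /lhs /x /x' /y /y'; field.
  have -> : x ^+ 2 * y ^+ 2 + x' ^+ 2 * y' ^+ 2 = k ^+ 2 - 2 * (x * y * x' * y').
    by rewrite -kE; ring.
  by rewrite r2 xE yE kE; field.
have k1 : k ^+ 2 <= 1.
  have : k ^+ 2 + (a1 * b2 - a2 * b1) ^+ 2 = (a1 ^+ 2 + a2 ^+ 2) * (b1 ^+ 2 + b2 ^+ 2).
    by rewrite /k; ring.
  by rewrite a b; have := sqr_ge0 (a1 * b2 - a2 * b1); lra.
(* This is the worst case over signs, with [y = |d e|] and [x = |k|]. For [x <= 1/2] all is clear
   from [y (1 - 2 x) >= 0]; otherwise complete the square and use [x / 2 >= x - 1/2]. *)
have key (y x : R) : 0 <= y -> 0 <= x -> x <= 1 ->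
    0 <= x ^+ 2 / 4 + y - 2 * y * x + y ^+ 2.
  move=> y0 x0 x1; have [xs|xl] := lerP x (1 / 2).
    by have := sqr_ge0 x; have := sqr_ge0 y; nra.
  by have := sqr_ge0 (y - (x - 1 / 2)); nra.
have kn : `|k| <= 1 by rewrite ler_norml; apply/andP; split; nra.
have := key `|d * e| `|k| (normr_ge0 _) (normr_ge0 _) kn.
rewrite !real_normK ?num_real// -mulrA -normrM.
have := ler_norm (- (d * e * k)); rewrite normrN.
have : `|d * e| <= (d ^+ 2 + e ^+ 2) / 2.
  by rewrite ler_norml; apply/andP; split; have := sqr_ge0 (d + e); have := sqr_ge0 (d - e); nra.
lra.
Qed.

End Averages.

(** * Weighted first moments of a harmonic function on the circle *)

Section FirstMoment.
Variable R : realType.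

Lemma harmonic_at_avg m (F : R -> R * R -> R) p t :
  (forall t, harmonic_at (F t) p) ->
  harmonic_at (fun w => avg m (fun t => F t w) t) p.
Proof.
move=> hF; elim: m t => [|m IH] t /=; first exact: hF.
have := harmonic_atZ 2^-1 (harmonic_atD (IH t) (IH (t + pi / 2 ^+ m))).
by congr harmonic_at; apply/funext => w; rewrite mulrC.
Qed.

Lemma continuous_avg m (T : topologicalType) (F : R -> T -> R) t :
  (forall t, continuous (F t)) -> continuous (fun w => avg m (fun t => F t w) t).
Proof.
move=> cF; elim: m t => [|m IH] t /=; first exact: cF.
by continuity; exact: IH.
Qed.

Lemma continuous_pair_comp (f : R * R -> R) (T : topologicalType) (a b : T -> R) :
  continuous f -> continuous a -> continuous b -> continuous (fun x => f (a x, b x)).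
Proof.
move=> cf ca cb x.
by apply: (@continuous_comp _ _ _ (fun x => (a x, b x)) f); [exact: continuous_pair|exact: cf].
Qed.

Variables (f : R * R -> R) (p q : R).
Hypothesis cf : continuous f.
Hypothesis hf : forall w, sqn w < 1 -> harmonic_at f w.
Hypothesis f0 : f (0, 0) = 0.
Hypothesis df : forall e, 0 < e -> \forall x \near (0 : R)^'+, forall t : R,
  `|f (x * cos t, x * sin t) - f (- (x * cos t), - (x * sin t))
    - 2 * x * (p * cos t + q * sin t)| <= e * x.

(* The rotational mean [T] of [f] with weight [l t = b1 cos t + b2 sin t - d] is
   harmonic and nearly affine on the circle, hence nearly affine in the disc. Its
   gradient at [0] is computed from that of [f] by [avg_first_moment]. *)
Lemma first_moment_le (b1 b2 d eps : R) : 0 < eps ->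
  exists m0, forall m, (m0 <= m)%N ->
  avg m (fun t => (b1 * cos t + b2 * sin t - d) * f (cos t, sin t)) 0
    <= (b1 * p + b2 * q) / 2 + eps.
Proof.
move=> eps0.
pose G t := f (cos t, sin t).
(* By the addition formulas, [l t] written in terms of [t + s] splits so that [T (cos s, sin s)] is
   [cos s * avg m u s + sin s * avg m v s + avg m z s]. Equidistribution makes the three averages
   nearly constant in [s], leaving an affine function. *)
pose u t := (b1 * cos t + b2 * sin t) * G t.
pose v t := (b1 * sin t - b2 * cos t) * G t.
pose z t := - d * G t.
pose l t : R := b1 * cos t + b2 * sin t - d.
have cc : continuous (@cos R) by exact: continuous_cos.
have cs : continuous (@sin R) by exact: continuous_sin.
have cG : continuous G by exact: continuous_pair_comp.
have cP (x : R) : cos (x + 2 * pi) = cos x.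
  by rewrite (_ : 2 * pi = pi *+ 2) ?cosD2pi// mulr2n mulrDl mul1r.
have sP (x : R) : sin (x + 2 * pi) = sin x.
  by rewrite (_ : 2 * pi = pi *+ 2) ?sinD2pi// mulr2n mulrDl mul1r.
have e0 : 0 < eps / 12 by lra.
have [m1 m1P] : exists m0, forall m, (m0 <= m)%N -> forall s, `|avg m u s - avg m u 0| <= eps / 12.
  apply: avg_equidistribution => //; first by move=> x; rewrite /u /G cP sP.
  by rewrite /u; continuity.
have [m2 m2P] : exists m0, forall m, (m0 <= m)%N -> forall s, `|avg m v s - avg m v 0| <= eps / 12.
  apply: avg_equidistribution => //; first by move=> x; rewrite /v /G cP sP.
  by rewrite /v; continuity.
have [m3 m3P] : exists m0, forall m, (m0 <= m)%N -> forall s, `|avg m z s - avg m z 0| <= eps / 12.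
  apply: avg_equidistribution => //; first by move=> x; rewrite /z /G cP sP.
  by rewrite /z; continuity.
exists (maxn 3 (maxn m1 (maxn m2 m3))) => m.
rewrite !geq_max => /and4P[lem lem1 lem2 lem3].
set al := avg m u 0 in m1P *; set be := avg m v 0 in m2P *; set ga := avg m z 0 in m3P *.
pose T (w : R * R) := avg m (fun t => l t * f (cos t * w.1 + - sin t * w.2,
  1 * (cos t * w.2 - - sin t * w.1))) 0.
pose D w := T w - (al * w.1 + be * w.2 + ga).
have cT : continuous T.
  apply: continuous_avg => t; continuity.
  by apply: continuous_pair_comp => //; continuity.
have hT w : sqn w < 1 -> harmonic_at T w.
  move=> w1; apply: harmonic_at_avg => t; apply: harmonic_atZ.
  apply: harmonic_at_conformal; first by left.
  apply: hf; apply: le_lt_trans w1; rewrite /sqn/=.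
  rewrite [leLHS](_ : _ = (cos t ^+ 2 + sin t ^+ 2) * (w.1 ^+ 2 + w.2 ^+ 2)).
    by rewrite cos2Dsin2 mul1r.
  by ring.
have cD : continuous D by rewrite /D; continuity.
have hD w : sqn w < 1 -> harmonic_at D w.
  by move=> w1; apply: harmonic_atB; [exact: hT|exact: harmonic_at_affine].
have Dc w : sqn w = 1 -> `|D w| <= eps / 4.
  move=> /circle_param[s ->].
  have TE : T (cos s, sin s) = cos s * avg m u s + sin s * avg m v s + avg m z s.
    rewrite -!avgZ -!avgD -[s in avg m _ s]add0r -avg_shift /T; apply: eq_avg => t /=.
    have E1 : cos t * cos s + - sin t * sin s = cos (t + s) by rewrite cosD; ring.
    have E2 : 1 * (cos t * sin s - - sin t * cos s) = sin (t + s) by rewrite sinD; ring.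
    rewrite E1 E2 /u /v /z -/(G _).
    have -> : l t = cos s * (b1 * cos (t + s) + b2 * sin (t + s))
        + sin s * (b1 * sin (t + s) - b2 * cos (t + s)) - d.
      rewrite cosD sinD /l.
      rewrite [X in _ = X - d](_ : _ = (b1 * cos t + b2 * sin t) * (cos s ^+ 2 + sin s ^+ 2)).
        by rewrite cos2Dsin2 mulr1.
      by ring.
    by ring.
  rewrite /D TE/= (_ : _ - _ = cos s * (avg m u s - al) + sin s * (avg m v s - be)
    + (avg m z s - ga)); last by ring.
  have A : `|cos s * (avg m u s - al)| <= eps / 12.
    by rewrite normrM -[leRHS]mul1r ler_pM// ?cos_max// m1P.
  have B : `|sin s * (avg m v s - be)| <= eps / 12.
    by rewrite normrM -[leRHS]mul1r ler_pM// ?sin_max// m2P.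
  have C := m3P m lem3 s.
  apply: le_trans (ler_normD _ _) _.
  have := ler_normD (cos s * (avg m u s - al)) (sin s * (avg m v s - be)).
  by lra.
have Dd w : sqn w <= 1 -> `|D w| <= eps / 4.
  move=> w1; rewrite ler_norml; apply/andP; split.
  - suff : - (eps / 4) - D w <= 0 by lra.
    apply: (@maximum_principle_disc _ (fun w => - (eps / 4) - D w)) => //.
    + by continuity.
    + by move=> y y1; apply: harmonic_atB; [exact: harmonic_at_cst|exact: hD].
    + by move=> y /Dc; rewrite ler_norml => /andP[]; lra.
  - suff : D w - eps / 4 <= 0 by lra.
    apply: (@maximum_principle_disc _ (fun w => D w - eps / 4)) => //.
    + by continuity.
    + by move=> y y1; apply: harmonic_atB; [exact: hD|exact: harmonic_at_cst].
    + by move=> y /Dc; rewrite ler_norml => /andP[]; lra.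
(* Since [f] vanishes at the origin, so does [T]. Hence the contribution [ga] of the unknown offset
   [d] is small. *)
have gae : ga <= eps / 4.
  have := Dd (0, 0); rewrite /D /T/= (@eq_avg _ m _ (fun=> 0)); last first.
    by move=> t; rewrite !mulr0 oppr0 !addr0 mulr0 f0 mulr0.
  rewrite avg_cst !mulr0 !add0r normrN => /(_ _)/ler_normlP[]//.
  by rewrite /sqn/= expr0n addr0.
have -> : avg m (fun t => l t * f (cos t, sin t)) 0 = al + ga.
  by rewrite -avgD; apply: eq_avg => t; rewrite /l /u /z /G; ring.
suff : al <= (b1 * p + b2 * q) / 2 + 3 / 4 * eps by lra.
pose L := `|b1| + `|b2| + `|d| + 1.
have L0 : 0 < L by rewrite ltr_wpDl// !addr_ge0.
have lL t : `|l t| <= L.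
  rewrite /l /L; apply: le_trans (ler_normB _ _) _.
  have := ler_normD (b1 * cos t) (b2 * sin t); rewrite !normrM.
  have : `|b1| * `|cos t| <= `|b1| by rewrite ler_piMr// cos_max.
  have : `|b2| * `|sin t| <= `|b2| by rewrite ler_piMr// sin_max.
  lra.
have eL : 0 < eps / 2 / L by rewrite divr_gt0//; lra.
have [x [x0 x1 dfx]] : exists x : R, [/\ 0 < x, x < 1 & forall t : R,
  `|f (x * cos t, x * sin t) - f (- (x * cos t), - (x * sin t))
    - 2 * x * (p * cos t + q * sin t)| <= eps / 2 / L * x].
  have H := df eL; apply: (@filter_ex _ (0:R)^'+); near=> x; split.
  - by near: x; exact: nbhs_right_gt.
  - by near: x; exact: nbhs_right_lt.
  - by near: x.
have x01 : 0 <= x <= 1 by rewrite !ltW.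
have M4 w : sqn w <= 1 -> `|- D w| <= eps / 4 by rewrite normrN; exact: Dd.
(* The error [D] is small only in absolute terms, but its odd difference is at most [eps * x]. It
   therefore survives the division by [x] that recovers the gradient. *)
have := @harmonic_odd_difference _ (fun w => - D w) (eps / 4) _ _ M4 x x01.
move=> /(_ _ _)/wrap[].
  by continuity.
  move=> w w1; have := harmonic_atZ (-1) (hD w w1).
  by congr harmonic_at; apply/funext => y; rewrite mulN1r.
rewrite /D/= !mulr0.
have TD : T (x, 0) - T (- x, 0) <= x * (b1 * p + b2 * q) + eps / 2 * x.
  pose h t := l t * (p * cos t + q * sin t).
  have hE : avg m h 0 = (b1 * p + b2 * q) / 2 by exact: avg_first_moment.
  have -> : x * (b1 * p + b2 * q) = 2 * x * avg m h 0 by rewrite hE; field.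
  pose k t := l t * f (x * cos t, x * sin t) + -1 * (l t * f (- (x * cos t), - (x * sin t))).
  have -> : T (x, 0) - T (- x, 0) = avg m k 0.
    rewrite /k avgD avgZ mulN1r /T/=; congr (_ - _); apply: eq_avg => t;
      congr (_ * f (_, _)); ring.
  rewrite -avgZ -lerBlDl.
  have := @avg_dist _ m k (fun t => 2 * x * h t) 0 (eps / 2 * x).
  move=> /(_ _)/wrap[]; last by rewrite ler_norml => /andP[].
  move=> t; rewrite (_ : k t - _ = l t * (f (x * cos t, x * sin t)
    - f (- (x * cos t), - (x * sin t)) - 2 * x * (p * cos t + q * sin t))); last first.
    by rewrite /k /h; ring.
  rewrite normrM; have -> : eps / 2 * x = L * (eps / 2 / L * x) by field; lra.
  by apply: ler_pM => //; exact: dfx.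
move=> H; have : al * (2 * x) <= ((b1 * p + b2 * q) / 2 + 3 / 4 * eps) * (2 * x) by lra.
by rewrite ler_pM2r// mulr_gt0.
Unshelve. all: by end_near. Qed.

End FirstMoment.

(** * Heinz' gradient bound *)

Section HeinzGradient.
Variable R : realType.

Lemma affine_circle_le2 (b1 b2 d t : R) : b1 ^+ 2 + b2 ^+ 2 = 1 -> `|d| <= 1 ->
  `|b1 * cos t + b2 * sin t - d| <= 2.
Proof.
move=> b d1; apply: le_trans (ler_normB _ _) _.
suff : `|b1 * cos t + b2 * sin t| <= 1 by lra.
have : (b1 * cos t + b2 * sin t) ^+ 2 <= 1.
  have : (b1 * cos t + b2 * sin t) ^+ 2 + (b1 * sin t - b2 * cos t) ^+ 2 =
    (b1 ^+ 2 + b2 ^+ 2) * (cos t ^+ 2 + sin t ^+ 2) by ring.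
  by rewrite b cos2Dsin2; have := sqr_ge0 (b1 * sin t - b2 * cos t); lra.
by move=> H; rewrite ler_norml; apply/andP; split; nra.
Qed.

(** The sign conditions give [l_i g_i = |l_i| |g_i|], and [|g_i| <= r] gives [r |g_i| >= g_i^2]. As
    both [|l_i|] are at most 2, [l1^2 l2^2 / 8] is below each of them, and the squares [g_i^2] add
    up to [r^2]. *)
Lemma weighted_sum_ge (l1 l2 g1 g2 r : R) : 0 < r -> `|l1| <= 2 -> `|l2| <= 2 ->
  0 <= l1 * g1 -> 0 <= l2 * g2 -> g1 ^+ 2 + g2 ^+ 2 = r ^+ 2 ->
  r / 8 * (l1 ^+ 2 * l2 ^+ 2) <= l1 * g1 + l2 * g2.
Proof.
move=> r0 l12 l22 lg1 lg2 g12.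
rewrite -(ger0_norm lg1) -(ger0_norm lg2) !normrM.
rewrite -(real_normK (num_real l1)) -(real_normK (num_real l2)).
move: g12; rewrite -(real_normK (num_real g1)) -(real_normK (num_real g2)).
move: l12 l22 (normr_ge0 l1) (normr_ge0 l2) (normr_ge0 g1) (normr_ge0 g2).
set A := `|l1|; set B := `|l2|; set a := `|g1|; set b := `|g2|.
move=> A2 B2 A0 B0 a0 b0 ab.
have ar : a <= r by nra.
have br : b <= r by nra.
have HA : A ^+ 2 * B ^+ 2 / 8 <= A.
  have B4 : B ^+ 2 <= 4 by nra.
  have AB : A * B ^+ 2 <= 2 * 4 by rewrite ler_pM ?sqr_ge0.
  have : A * (A * B ^+ 2) <= A * (2 * 4) by rewrite ler_wpM2l.
  by lra.
have HB : A ^+ 2 * B ^+ 2 / 8 <= B.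
  have A4 : A ^+ 2 <= 4 by nra.
  have AB : B * A ^+ 2 <= 2 * 4 by rewrite ler_pM ?sqr_ge0.
  have : B * (B * A ^+ 2) <= B * (2 * 4) by rewrite ler_wpM2l.
  by lra.
rewrite -(ler_pM2l r0).
have E1 : A * a ^+ 2 <= r * (A * a) by have := mulr_ge0 A0 a0; nra.
have E2 : B * b ^+ 2 <= r * (B * b) by have := mulr_ge0 B0 b0; nra.
have E3 : (A ^+ 2 * B ^+ 2 / 8) * a ^+ 2 <= A * a ^+ 2 by rewrite ler_wpM2r ?sqr_ge0.
have E4 : (A ^+ 2 * B ^+ 2 / 8) * b ^+ 2 <= B * b ^+ 2 by rewrite ler_wpM2r ?sqr_ge0.
have -> : r * (r / 8 * (A ^+ 2 * B ^+ 2)) = A ^+ 2 * B ^+ 2 / 8 * r ^+ 2 by field.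
by rewrite -ab; lra.
Qed.

(** The pair [(p, q)] is the gradient at the origin, read off from central differences uniformly in
    the direction. Central differences match the quantity bounded by [harmonic_odd_difference]. *)
Definition odd_derivative (f : R * R -> R) (p q : R) := forall e, 0 < e ->
  \forall x \near (0 : R)^'+, forall t : R,
  `|f (x * cos t, x * sin t) - f (- (x * cos t), - (x * sin t))
    - 2 * x * (p * cos t + q * sin t)| <= e * x.

(** Average [weighted_sum_ge] over the circle: [avg_fourth_moment_ge] bounds one side from below,
    [first_moment_le] the other from above. Cauchy-Schwarz and [(x + y)^2 <= 2 (x^2 + y^2)] then
    pass to the gradients. *)
Lemma heinz_gradient (f1 f2 : R * R -> R) (r b1 b2 d c1 c2 e p1 q1 p2 q2 : R) :
  0 < r -> continuous f1 -> continuous f2 ->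
  (forall w, sqn w < 1 -> harmonic_at f1 w) ->
  (forall w, sqn w < 1 -> harmonic_at f2 w) ->
  f1 (0, 0) = 0 -> f2 (0, 0) = 0 ->
  odd_derivative f1 p1 q1 -> odd_derivative f2 p2 q2 ->
  (forall w, sqn w = 1 -> f1 w ^+ 2 + f2 w ^+ 2 = r ^+ 2) ->
  b1 ^+ 2 + b2 ^+ 2 = 1 -> `|d| <= 1 ->
  (forall w, sqn w = 1 -> 0 <= (b1 * w.1 + b2 * w.2 - d) * f1 w) ->
  c1 ^+ 2 + c2 ^+ 2 = 1 -> `|e| <= 1 ->
  (forall w, sqn w = 1 -> 0 <= (c1 * w.1 + c2 * w.2 - e) * f2 w) ->
  r ^+ 2 / 2048 <= p1 ^+ 2 + q1 ^+ 2 + p2 ^+ 2 + q2 ^+ 2.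
Proof.
move=> r0 cf1 cf2 hf1 hf2 f10 f20 df1 df2 fr b d1 lf1 c e1 lf2.
suff H : r / 32 <= b1 * p1 + b2 * q1 + c1 * p2 + c2 * q2.
  have A : (b1 * p1 + b2 * q1) ^+ 2 <= p1 ^+ 2 + q1 ^+ 2.
    rewrite -[leRHS]mul1r -b; have := sqr_ge0 (b1 * q1 - b2 * p1); lra.
  have B : (c1 * p2 + c2 * q2) ^+ 2 <= p2 ^+ 2 + q2 ^+ 2.
    rewrite -[leRHS]mul1r -c; have := sqr_ge0 (c1 * q2 - c2 * p2); lra.
  move: H A B; set x := b1 * p1 + _; rewrite -(addrA x); set y := c1 * p2 + _.
  have := sqr_ge0 (x - y); move=> ? ? ? ?.
  have : (r / 32) ^+ 2 <= (x + y) ^+ 2 by rewrite ler_sqr ?nnegrE; lra.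
  by rewrite exprMn; lra.
suff : r / 64 <= (b1 * p1 + b2 * q1) / 2 + (c1 * p2 + c2 * q2) / 2 by lra.
apply/ler_addgt0Pr => eps eps0; have eps2 : 0 < eps / 2 by lra.
have [m1 m1P] := first_moment_le cf1 hf1 f10 df1 b1 b2 d eps2.
have [m2 m2P] := first_moment_le cf2 hf2 f20 df2 c1 c2 e eps2.
pose m := maxn 3 (maxn m1 m2).
have m3 : (3 <= m)%N by rewrite leq_max.
have {}m1P := m1P m; have {}m2P := m2P m.
have lem1 : (m1 <= m)%N by rewrite /m !leq_max leqnn orbT.
have lem2 : (m2 <= m)%N by rewrite /m !leq_max leqnn !orbT.
have := m1P lem1; have := m2P lem2.
have := avg_fourth_moment_ge d e 0 m3 b c.
set A4 := avg _ _ _; set A1 := avg _ _ _; set A2 := avg _ _ _.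
suff : r / 8 * A4 <= A2 + A1 by nra.
rewrite -avgZ -avgD; apply: avg_le => t.
have ct : sqn (cos t, sin t) = 1 by exact: cos2Dsin2.
apply: weighted_sum_ge => //; first exact: affine_circle_le2.
- exact: affine_circle_le2.
- exact: lf1 _ ct.
- exact: lf2 _ ct.
- exact: fr.
Qed.

End HeinzGradient.

(** * A line separating the sign changes of a coordinate on the circle *)

Section SignLine.
Variable R : realType.

Lemma continuous_comp_within (S T U : topologicalType) (A : set T) (g : T -> U)
    (e : S -> T) : {within A, continuous g} -> continuous e ->
  (forall s, A (e s)) -> continuous (fun s => g (e s)).
Proof.
move=> /subspace_continuousP cg ce Ae s B /(cg _ (Ae s)) gB.
have := ce s _ gB; rewrite /nbhs/=; apply: filterS => x /=; apply; exact: Ae.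
Qed.

Lemma nonvanishing_same_sign (h : R -> R) (a b : R) : continuous h ->
  (forall t, Num.min a b <= t <= Num.max a b -> h t != 0) -> 0 < h a * h b.
Proof.
move=> ch; wlog ab : a b / a <= b => [H|].
  have [ab|] := boolP (a <= b); first exact: H.
  by rewrite -ltNge minC maxC mulrC => /ltW ba hn; exact: H.
rewrite min_l// max_r// => hn; rewrite ltNge; apply/negP => hab.
have [||c cab hc] := @IVT R h a b 0 ab; first exact: continuous_subspaceT.
  rewrite ge_min le_max.
  have [ha|ha] := lerP (h a) 0; have [hb|hb] := lerP 0 (h b); rewrite ?orbT//=.
  - have ha0 : h a != 0 by apply: hn; rewrite lexx.
    by have : h a < 0; [rewrite lt_neqAle ha0|nra].
  - have hb0 : h b != 0 by apply: hn; rewrite lexx andbT.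
    by have : 0 < h b; [rewrite lt_neqAle eq_sym hb0|nra].
  - by rewrite (ltW hb) (ltW ha).
by have := hn c; rewrite hc eqxx; move: cab; rewrite in_itv/= => -> /(_ isT).
Qed.

Lemma half_circle_param (u v : R) : u ^+ 2 + v ^+ 2 = 1 -> 0 < u ->
  exists t, [/\ - (pi / 2) < t < pi / 2, u = cos t & v = sin t].
Proof.
move=> uv u0; have v1 : -1 <= v <= 1 by apply/andP; split; nra.
have vlt : -1 < v < 1.
  by apply/andP; split; rewrite lt_neqAle; apply/andP; split; try (apply/eqP => E; nra); lra.
case/andP: (vlt) => va vb.
exists (asin v); split.
- by rewrite asin_gtNpi2 ?asin_ltpi2 ?va ?vb ?ltW.
- by rewrite cos_asin// -uv addrK sqrtr_sqr gtr0_norm.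
- by rewrite asinK// in_itv.
Qed.

Lemma chord_meets_circle (P Q x n : R * R) : sqn P = 1 -> sqn Q = 1 -> sqn x = 1 ->
  sqn n = 1 -> n.1 * P.1 + n.2 * P.2 = n.1 * Q.1 + n.2 * Q.2 -> P <> Q ->
  n.1 * x.1 + n.2 * x.2 = n.1 * P.1 + n.2 * P.2 -> x = P \/ x = Q.
Proof.
case: P Q x n => [P1 P2] [Q1 Q2] [x1 x2] [n1 n2]; rewrite /sqn/= => hP hQ hx hn nPQ PQ nx.
(* The normal coordinates agree, hence the tangential ones agree up to sign. *)
pose tg a b := n1 * b - n2 * a; pose nm a b := n1 * a + n2 * b.
have sq a b : a ^+ 2 + b ^+ 2 = 1 -> tg a b ^+ 2 = 1 - nm a b ^+ 2.
  move=> ab; suff : tg a b ^+ 2 + nm a b ^+ 2 = (n1 ^+ 2 + n2 ^+ 2) * (a ^+ 2 + b ^+ 2).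
    by rewrite hn ab; lra.
  by rewrite /tg /nm; ring.
have rec a b : (a, b) = (n1 * nm a b - n2 * tg a b, n2 * nm a b + n1 * tg a b).
  by congr (_, _); rewrite /nm /tg; [rewrite -[LHS]mul1r -hn; ring|rewrite -[LHS]mul1r -hn; ring].
have tPQ : tg P1 P2 = - tg Q1 Q2.
  have : tg P1 P2 ^+ 2 == tg Q1 Q2 ^+ 2 by rewrite (sq _ _ hP) (sq _ _ hQ) /nm nPQ.
  rewrite eqf_sqr => /orP[/eqP E|/eqP//].
  by exfalso; apply: PQ; rewrite (rec P1) (rec Q1) E /nm nPQ.
have : tg x1 x2 ^+ 2 == tg P1 P2 ^+ 2 by rewrite (sq _ _ hx) (sq _ _ hP) /nm nx.
rewrite eqf_sqr => /orP[|] /eqP E; [left|right].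
- by rewrite (rec x1) (rec P1) E /nm nx.
- by rewrite (rec x1) (rec Q1) E tPQ opprK /nm nx nPQ.
Qed.

(* The line runs through the preimages of the two zeros of [cos a y1 + sin a y2]
   on the target circle. By the intermediate value theorem it separates the
   preimages of the two half circles. *)
Lemma exists_sign_line (F g : R * R -> R * R) (r a : R) : 0 < r ->
  (forall x, sqn x = 1 -> sqn (F x) = r ^+ 2) ->
  (forall y, sqn y = r ^+ 2 -> sqn (g y) = 1) ->
  {within [set y | sqn y = r ^+ 2], continuous g} ->
  (forall x, sqn x = 1 -> g (F x) = x) ->
  (forall y, sqn y = r ^+ 2 -> F (g y) = y) ->
  exists b1 b2 d, [/\ b1 ^+ 2 + b2 ^+ 2 = 1, `|d| <= 1 &
    forall x, sqn x = 1 ->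
      0 <= (b1 * x.1 + b2 * x.2 - d) * (cos a * (F x).1 + sin a * (F x).2)].
Proof.
move=> r0 Fc gc cg gF Fg.
pose E t : R * R := (r * cos t, r * sin t).
have Ec t : sqn (E t) = r ^+ 2.
  by rewrite /sqn/= !exprMn -mulrDr cos2Dsin2 mulr1.
have cE : continuous E.
  by rewrite /E; continuity; [exact: continuous_cos|exact: continuous_sin].
pose G t := g (E t).
have cG : continuous G by exact: (continuous_comp_within cg cE Ec).
pose fa (y : R * R) := cos a * y.1 + sin a * y.2.
have faE t : fa (E t) = r * cos (t - a) by rewrite /fa/= cosB; ring.
pose P := G (a + pi / 2); pose Q := G (a - pi / 2).
have hP : sqn P = 1 by exact: gc.
have hQ : sqn Q = 1 by exact: gc.
have FP : F P = E (a + pi / 2) by exact: Fg.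
have FQ : F Q = E (a - pi / 2) by exact: Fg.
have faP : fa (F P) = 0.
  by rewrite FP faE [a + _]addrC addrK cos_pihalf mulr0.
have faQ : fa (F Q) = 0.
  by rewrite FQ faE addrAC subrr add0r cosN cos_pihalf mulr0.
have PQ : P <> Q.
  move=> /(congr1 F); rewrite FP FQ /E cosDpihalf sinDpihalf cosBpihalf sinBpihalf.
  case=> /(mulfI (lt0r_neq0 r0)) A /(mulfI (lt0r_neq0 r0)) B.
  by have := cos2Dsin2 a; nra.
have zeros x : sqn x = 1 -> fa (F x) = 0 -> x = P \/ x = Q.
  move=> x1 fx; have := Fc x x1; move: fx; rewrite /fa /sqn.
  case EF : (F x) => [y1 y2] /= fy sy.
  pose v := - sin a * y1 + cos a * y2.
  have y1E : y1 = - sin a * v.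
    rewrite -[LHS]mul1r -(cos2Dsin2 a) -[RHS](addr0) -(mulr0 (cos a)) -fy /v; ring.
  have y2E : y2 = cos a * v.
    rewrite -[LHS]mul1r -(cos2Dsin2 a) -[RHS](addr0) -(mulr0 (sin a)) -fy /v; ring.
  have : v ^+ 2 == r ^+ 2.
    by rewrite -sy y1E y2E -[X in X == _]mul1r -(cos2Dsin2 a); apply/eqP; ring.
  rewrite eqf_sqr => /orP[|] /eqP vr; [left|right]; rewrite -(gF _ x1) EF y1E y2E vr /P /Q /G;
    congr g; rewrite /E ?cosDpihalf ?sinDpihalf ?cosBpihalf ?sinBpihalf; congr (_, _); ring.
pose N := Num.sqrt (sqn (P.1 - Q.1, P.2 - Q.2)).
have N0 : 0 < N.
  rewrite sqrtr_gt0 lt_neqAle sqn_ge0 andbT eq_sym; apply/eqP => /eqP.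
  rewrite /sqn/= paddr_eq0 ?sqr_ge0// !sqrf_eq0 !subr_eq0 => /andP[/eqP A /eqP B].
  by apply: PQ; rewrite [P]surjective_pairing [Q]surjective_pairing A B.
have N2 : N ^+ 2 = (P.1 - Q.1) ^+ 2 + (P.2 - Q.2) ^+ 2 by rewrite sqr_sqrtr ?sqn_ge0.
pose n : R * R := ((P.2 - Q.2) / N, (Q.1 - P.1) / N).
have n1 : sqn n = 1.
  rewrite /sqn/= !exprMn -mulrDl exprVn N2.
  rewrite (_ : _ + _ = (P.1 - Q.1) ^+ 2 + (P.2 - Q.2) ^+ 2); last by ring.
  by rewrite divff// -N2 expf_neq0// lt0r_neq0.
pose d := n.1 * P.1 + n.2 * P.2.
have nQ : n.1 * P.1 + n.2 * P.2 = n.1 * Q.1 + n.2 * Q.2.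
  by rewrite /n/=; field; exact: lt0r_neq0.
pose L (x : R * R) := n.1 * x.1 + n.2 * x.2 - d.
have LP : L P = 0 by rewrite /L subrr.
have LQ : L Q = 0 by rewrite /L -nQ subrr.
have L0 x : sqn x = 1 -> L x = 0 -> fa (F x) = 0.
  move=> x1 /eqP; rewrite subr_eq0 => /eqP Lx.
  by have [->|->] := chord_meets_circle hP hQ x1 n1 nQ PQ Lx.
have cL0 : continuous L by rewrite /L; continuity.
have cL : continuous (fun t => L (G t)).
  by move=> t; apply: (@continuous_comp _ _ _ G L); [exact: cG|exact: cL0].
(* The target half circle where [s * fa > 0] is centred at angle [a] for [s = 1] and at [a + pi] for
   [s = -1]. On the arc from its centre to [F x] the form [fa] has no zero, so [L] has none on the
   preimage of that arc. *)
have half s x : s = 1 \/ s = -1 -> sqn x = 1 -> 0 < s * fa (F x) ->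
    0 < L (G (if s == 1 then a else a + pi)) * L x.
  move=> s1 x1 fx.
  set b := if s == 1 then a else a + pi.
  have cb : cos b = s * cos a.
    rewrite /b; case: s1 => ->; rewrite ?eqxx ?mul1r//.
    by rewrite (_ : (-1 == 1 :> R) = false) ?cosDpi ?mulN1r//; apply/eqP; lra.
  have sb : sin b = s * sin a.
    rewrite /b; case: s1 => ->; rewrite ?eqxx ?mul1r//.
    by rewrite (_ : (-1 == 1 :> R) = false) ?sinDpi ?mulN1r//; apply/eqP; lra.
  have s2 : s ^+ 2 = 1 by case: s1 => ->; ring.
  have := Fc x x1; move: fx; rewrite /fa /sqn.
  case EF: (F x) => [y1 y2] /= fy sy.
  have [||t [tb ut vt]] := @half_circle_param ((cos b * y1 + sin b * y2) / r)
    ((cos b * y2 - sin b * y1) / r).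
  - have rn : r ^+ 2 != 0 by rewrite expf_neq0// lt0r_neq0.
    apply: (mulIf rn); rewrite mul1r -{2}sy -[RHS]mul1r -(cos2Dsin2 b).
    by field; exact: lt0r_neq0.
  - by rewrite divr_gt0// cb sb -!mulrA -mulrDr.
  have yE : (y1, y2) = E (b + t).
    rewrite /E cosD sinD -ut -vt; congr (_, _).
      rewrite -[LHS]mul1r -(cos2Dsin2 b); field; exact: lt0r_neq0.
    rewrite -[LHS]mul1r -(cos2Dsin2 b); field; exact: lt0r_neq0.
  rewrite -(gF _ x1) EF yE -/(G _).
  apply: (@nonvanishing_same_sign (fun t => L (G t))) => // z zb.
  apply/eqP => Lz; have := L0 (G z) (gc _ (Ec z)) Lz; rewrite /G Fg// => fz.
  have : 0 < cos (z - b).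
    apply: cos_gt0_pihalf; move: zb tb.
    have [t0|t0] := lerP 0 t.
      rewrite min_l ?max_r ?lerDl// => /andP[? ?] /andP[? ?].
      have pi0 := @pi_gt0 R; apply/andP; split; lra.
    have bt : b + t <= b by lra.
    rewrite min_r ?max_l// => /andP[? ?] /andP[? ?].
    have pi0 := @pi_gt0 R; apply/andP; split; lra.
  have : s * fa (E z) = r * cos (z - b) by rewrite /fa /E/= cosB cb sb; ring.
  rewrite fz mulr0 => /eqP; rewrite eq_sym mulf_eq0 => /orP[/eqP|/eqP ->].
    by move=> rz; rewrite rz ltxx in r0.
  by rewrite ltxx.
have d1 : `|d| <= 1.
  have : d ^+ 2 <= 1.
    have : d ^+ 2 + (n.1 * P.2 - n.2 * P.1) ^+ 2 = sqn n * sqn P by rewrite /d /sqn; ring.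
    by rewrite n1 hP; have := sqr_ge0 (n.1 * P.2 - n.2 * P.1); lra.
  by move=> H; rewrite ler_norml; apply/andP; split; nra.
have N1 : (-1 == 1 :> R) = false by apply/eqP; lra.
set h1 := L (G a); set h2 := L (G (a + pi)).
have H1 x : sqn x = 1 -> 0 < fa (F x) -> 0 < h1 * L x.
  by move=> x1 fx; have := @half 1 x; rewrite eqxx mul1r; apply => //; left.
have H2 x : sqn x = 1 -> fa (F x) < 0 -> 0 < h2 * L x.
  by move=> x1 fx; have := @half (-1) x; rewrite N1 mulN1r oppr_gt0; apply => //; right.
(* If both half circles had preimages on the same side, [h1 * L] would be nonnegative on the whole
   circle. Evaluated at [n] and [- n] this forces [|d| = 1]: the line is tangent and meets the
   circle only once, against [P <> Q]. *)
have h12 : h1 * h2 < 0.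
  have fh1 : 0 < fa (F (G a)) by rewrite /G Fg// faE subrr cos0 mulr1.
  have fh2 : fa (F (G (a + pi))) < 0.
    by rewrite /G Fg// faE addrAC subrr add0r cospi mulrN1 oppr_lt0.
  have K1 := H1 _ (gc _ (Ec a)) fh1; have K2 := H2 _ (gc _ (Ec _)) fh2.
  rewrite -/h1 -/(G _) -/h1 in K1; rewrite -/(G _) -/h2 in K2.
  rewrite ltNge; apply/negP => h12.
  have pos x : sqn x = 1 -> 0 <= h1 * L x.
    move=> x1; have [fx|fx|fx] := ltrgt0P (fa (F x)).
    - exact/ltW/H1.
    - have := H2 x x1 fx.
      have [h10|h10|h10] := ltrgt0P h1; last by rewrite h10 mul0r.
      + rewrite pmulr_rge0// => h2L.
        have h20 : 0 <= h2 by rewrite -(pmulr_rge0 _ h10).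
        by rewrite leNgt; apply/negP => Lx; nra.
      + rewrite nmulr_rge0// => h2L.
        have h20 : h2 <= 0 by rewrite -(nmulr_rge0 _ h10).
        by rewrite leNgt; apply/negP => Lx; nra.
    - by have [->|->] := zeros x x1 fx; rewrite ?LP ?LQ mulr0.
  have A := pos n n1.
  have B : 0 <= h1 * L (- n.1, - n.2) by apply: pos; rewrite /sqn/= !sqrrN.
  move: A B; rewrite /L/= -!expr2 !mulrN -opprD -!expr2 -/(sqn n) n1 => A B.
  have dd : d = 1 \/ d = -1.
    move: d1; rewrite ler_norml => /andP[d1 d2].
    have [h10|h10] := ltrP 0 h1; [right|left].
      by apply/eqP; rewrite eq_le; apply/andP; split => //; nra.
    have h10' : h1 < 0 by nra.
    by apply/eqP; rewrite eq_le; apply/andP; split => //; nra.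
  have idn (u v : R * R) k : sqn (u.1 - k * v.1, u.2 - k * v.2) =
      sqn u - 2 * k * (v.1 * u.1 + v.2 * u.2) + k ^+ 2 * sqn v.
    by rewrite /sqn/=; ring.
  have uniq x : sqn x = 1 -> n.1 * x.1 + n.2 * x.2 = d -> x = (d * n.1, d * n.2).
    move=> x1 nx; have d2 : d ^+ 2 = 1 by case: dd => ->; ring.
    have : sqn (x.1 - d * n.1, x.2 - d * n.2) = 0.
      rewrite idn.
      by rewrite x1 nx n1 -mulrA -expr2 d2; ring.
    move=> /eqP; rewrite /sqn/= paddr_eq0 ?sqr_ge0// !sqrf_eq0 !subr_eq0.
    by move=> /andP[/eqP X1 /eqP X2]; rewrite [LHS]surjective_pairing X1 X2.
  by apply: PQ; rewrite (uniq P)// (uniq Q)// -nQ.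
(* Orient the line so that its affine function is positive where [fa (F x) > 0]; by [h12] it is then
   negative where [fa (F x) < 0]. *)
pose sg := Num.sg h1.
have h10 : h1 != 0 by apply/eqP => h10; rewrite h10 mul0r ltxx in h12.
have sg2 : sg ^+ 2 = 1 by rewrite sqr_sg h10.
exists (sg * n.1), (sg * n.2), (sg * d); split.
- rewrite [LHS](_ : _ = sg ^+ 2 * sqn n); first by rewrite sg2 n1 mulr1.
  by rewrite /sqn; ring.
- by rewrite normrM normr_sg h10 mul1r d1.
move=> x x1; rewrite -/(fa (F x)).
rewrite (_ : _ * _ + _ - _ = sg * L x); last by rewrite /L; ring.
have sgP : 0 <= sg * h1 by rewrite /sg -normrEsg normr_ge0.
have sgP2 : sg * h2 <= 0.
  have : 0 <= (h1 ^+ 2) * - (sg * h2).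
    rewrite [X in 0 <= X](_ : _ = (sg * h1) * - (h1 * h2)); last by ring.
    by rewrite mulr_ge0// oppr_ge0 ltW.
  by rewrite pmulr_rge0 ?oppr_ge0// lt_neqAle eq_sym sqrf_eq0 h10 sqr_ge0.
have h1p : 0 < h1 ^+ 2 by rewrite lt_neqAle eq_sym sqrf_eq0 h10 sqr_ge0.
have h2p : 0 < h2 ^+ 2.
  rewrite lt_neqAle eq_sym sqrf_eq0 sqr_ge0 andbT.
  by apply/eqP => h20; rewrite h20 mulr0 ltxx in h12.
have [fx|fx|->] := ltrgt0P (fa (F x)); last by rewrite mulr0.
- rewrite mulr_ge0 ?(ltW fx)//.
  have K := H1 x x1 fx; have : 0 <= h1 ^+ 2 * (sg * L x).
    rewrite [X in 0 <= X](_ : _ = (sg * h1) * (h1 * L x)); last by ring.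
    by rewrite mulr_ge0// ltW.
  by rewrite (pmulr_rge0 _ h1p).
- rewrite mulr_le0 ?(ltW fx)//.
  have K := H2 x x1 fx; have : 0 <= h2 ^+ 2 * - (sg * L x).
    rewrite [X in 0 <= X](_ : _ = - (sg * h2) * (h2 * L x)); last by ring.
    by rewrite mulr_ge0 ?oppr_ge0// ltW.
  by rewrite (pmulr_rge0 _ h2p) oppr_ge0.
Qed.

End SignLine.

(** * Taylor expansions *)

Section Taylor.
Variable R : realType.
Implicit Types (f : R * R -> R) (x y : R -> R) (p : R * R).

Lemma cvg_eq_near (T : Type) (F : set_system T) (FF : Filter F) (u v : T -> R) (l : R) :
  (\forall t \near F, u t = v t) -> u @ F --> l -> v @ F --> l.
Proof.
move=> uv ul A /ul; rewrite /nbhs/= => uA.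
by apply: filterS2 uv uA => t /= ->.
Qed.

(* [x t = b t + d t^2 + o(t^2)]; thus [d] is half of the second derivative. *)
Definition expansion x (b d : R) := (fun t => (x t - b * t) / t ^+ 2) @ 0^'+ --> d.

Lemma expansion_order1 x b d : expansion x b d -> (fun t => x t / t) @ 0^'+ --> b.
Proof.
move=> xb.
have H : (fun t => (x t - b * t) / t ^+ 2 * t + b) @ 0^'+ --> d * 0 + b.
  apply: cvgD; last exact: cvg_cst.
  by apply: cvgM xb _; apply: cvg_at_right_filter; exact: cvg_id.
rewrite mulr0 add0r in H; apply: cvg_eq_near H; near=> t.
by field; apply: lt0r_neq0; near: t; exact: nbhs_right_gt.
Unshelve. all: by end_near. Qed.

Lemma expansion_unique x b d b' d' : expansion x b d -> expansion x b' d' ->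
  b = b' /\ d = d'.
Proof.
move=> xb xb'.
have bb : b = b' by apply: cvg_unique (expansion_order1 xb) (expansion_order1 xb').
by split=> //; move: xb'; rewrite -bb => xb'; exact: cvg_unique xb xb'.
Qed.

Lemma expansionD x y b d b' d' : expansion x b d -> expansion y b' d' ->
  expansion (fun t => x t + y t) (b + b') (d + d').
Proof.
move=> xb yb; have H : (fun t => (x t - b * t) / t ^+ 2 + (y t - b' * t) / t ^+ 2) @ 0^'+ --> d + d'.
  exact: cvgD.
apply: cvg_eq_near H; near=> t.
by rewrite -mulrDl; congr (_ / _); ring.
Unshelve. all: by end_near. Qed.

Lemma expansion_linear a : expansion (fun t => t * a) a 0.
Proof.
apply: (@cvg_eq_near _ _ _ (fun=> 0)); last exact: cvg_cst.
by near=> t; rewrite [t * a]mulrC subrr mul0r.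
Unshelve. all: by end_near. Qed.

Lemma expansion_near x y b d : (\forall t \near (0 : R)^'+, x t = y t) ->
  expansion x b d -> expansion y b d.
Proof.
move=> xy xb; apply: (@cvg_eq_near _ _ _ _ _ _ _ xb).
by apply: filterS xy => t ->.
Qed.

Definition taylor2 f p (b c d e g : R) := forall eps, 0 < eps ->
  \forall h \near ((0, 0) : R * R),
  `|f (p.1 + h.1, p.2 + h.2) - f p - (b * h.1 + c * h.2)
    - (d * h.1 ^+ 2 + 2 * e * (h.1 * h.2) + g * h.2 ^+ 2) / 2|
  <= eps * (h.1 ^+ 2 + h.2 ^+ 2).

(** The second-order chain rule along a curve. Divided by [t^2], the Peano remainder tends to 0
    because [x1 t / t] and [x2 t / t] stay bounded. *)
Lemma taylor2_curve f p b c d e g x1 a1 d1 x2 a2 d2 :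
  taylor2 f p b c d e g -> expansion x1 a1 d1 -> expansion x2 a2 d2 ->
  expansion (fun t => f (p.1 + x1 t, p.2 + x2 t) - f p) (b * a1 + c * a2)
    (b * d1 + c * d2 + (d * a1 ^+ 2 + 2 * e * (a1 * a2) + g * a2 ^+ 2) / 2).
Proof.
move=> tf xa1 xa2.
have m1 := expansion_order1 xa1; have m2 := expansion_order1 xa2.
pose q u v := (d * u ^+ 2 + 2 * e * (u * v) + g * v ^+ 2) / 2.
pose rest t := (f (p.1 + x1 t, p.2 + x2 t) - f p - (b * x1 t + c * x2 t)
  - q (x1 t) (x2 t)) / t ^+ 2.
have x0 x a l : expansion x a l -> x @ 0^'+ --> 0.
  move=> /expansion_order1 xt.
  have : (fun t => x t / t * t) @ 0^'+ --> a * 0.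
    by apply: cvgM xt _; apply: cvg_at_right_filter; exact: cvg_id.
  rewrite mulr0; apply: cvg_eq_near; near=> t.
  by rewrite divfK//; apply: lt0r_neq0; near: t; exact: nbhs_right_gt.
have r0 : rest @ 0^'+ --> 0.
  apply/cvgrPdist_le => eps eps0.
  have K0 : 0 < a1 ^+ 2 + a2 ^+ 2 + 1 by rewrite ltr_wpDl// addr_ge0 ?sqr_ge0.
  have e0 : 0 < eps / (a1 ^+ 2 + a2 ^+ 2 + 1) by rewrite divr_gt0.
  have cx : (fun t => (x1 t, x2 t)) @ 0^'+ --> ((0, 0) : R * R).
    exact: (cvg_pair (x0 _ _ _ xa1) (x0 _ _ _ xa2)).
  have H1 := cx _ (tf _ e0).
  have H2 : (fun t => (x1 t / t) ^+ 2 + (x2 t / t) ^+ 2) @ 0^'+ --> a1 ^+ 2 + a2 ^+ 2.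
    by apply: cvgD; apply: cvg_exprn.
  have H3 : \forall t \near (0 : R)^'+, (x1 t / t) ^+ 2 + (x2 t / t) ^+ 2 <= a1 ^+ 2 + a2 ^+ 2 + 1.
    have /cvgrPdist_le/(_ 1 ltr01) := H2.
    by apply: filterS => t; rewrite ler_norml => /andP[]; lra.
  near=> t.
  have t0 : 0 < t by near: t; exact: nbhs_right_gt.
  rewrite sub0r normrN /rest normrM normfV (ger0_norm (sqr_ge0 t)).
  rewrite ler_pdivrMr ?exprn_gt0//.
  have A : `|f (p.1 + x1 t, p.2 + x2 t) - f p - (b * x1 t + c * x2 t)
     - q (x1 t) (x2 t)| <= eps / (a1 ^+ 2 + a2 ^+ 2 + 1) * (x1 t ^+ 2 + x2 t ^+ 2).
    by near: t; exact: H1.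
  apply: le_trans A _.
  have B : (x1 t / t) ^+ 2 + (x2 t / t) ^+ 2 <= a1 ^+ 2 + a2 ^+ 2 + 1 by near: t; exact: H3.
  have E : x1 t ^+ 2 + x2 t ^+ 2 = ((x1 t / t) ^+ 2 + (x2 t / t) ^+ 2) * t ^+ 2.
    by field; exact: lt0r_neq0.
  rewrite E mulrA ler_wpM2r ?sqr_ge0// mulrAC ler_pdivrMr//.
  by rewrite ler_wpM2l// ltW.
have H : (fun t => b * ((x1 t - a1 * t) / t ^+ 2) + c * ((x2 t - a2 * t) / t ^+ 2)
    + q (x1 t / t) (x2 t / t) + rest t) @ 0^'+ --> b * d1 + c * d2 + q a1 a2 + 0.
  apply: cvgD r0; apply: cvgD.
    by apply: cvgD; (apply: cvgM; [exact: cvg_cst|]).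
  apply: cvgM; last exact: cvg_cst.
  apply: cvgD; first apply: cvgD.
  - by apply: cvgM; [exact: cvg_cst|exact: cvg_exprn].
  - by apply: cvgM; [exact: cvg_cst|exact: cvgM].
  - by apply: cvgM; [exact: cvg_cst|exact: cvg_exprn].
rewrite addr0 in H; apply: cvg_eq_near H; near=> t.
rewrite /rest /q; field; apply: lt0r_neq0; near: t; exact: nbhs_right_gt.
Unshelve. all: by end_near. Qed.

Lemma taylor2_line f p b c d e g (h1 h2 : R) : taylor2 f p b c d e g ->
  expansion (fun t => f (p.1 + t * h1, p.2 + t * h2) - f p) (b * h1 + c * h2)
    ((d * h1 ^+ 2 + 2 * e * (h1 * h2) + g * h2 ^+ 2) / 2).
Proof.
move=> tf; have := taylor2_curve tf (expansion_linear h1) (expansion_linear h2).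
by rewrite !mulr0 !add0r.
Qed.

Lemma taylor2_unique f p b c d e g b' c' d' e' g' :
  taylor2 f p b c d e g -> taylor2 f p b' c' d' e' g' ->
  [/\ b = b', c = c', d = d', e = e' & g = g'].
Proof.
move=> t1 t2.
have [] := expansion_unique (taylor2_line (h1 := 1) (h2 := 0) t1) (taylor2_line (h1 := 1) (h2 := 0) t2).
have [] := expansion_unique (taylor2_line (h1 := 0) (h2 := 1) t1) (taylor2_line (h1 := 0) (h2 := 1) t2).
have [] := expansion_unique (taylor2_line (h1 := 1) (h2 := 1) t1) (taylor2_line (h1 := 1) (h2 := 1) t2).
move=> *; split; lra.
Qed.

(** Over the four arms of the cross the first-order and mixed terms cancel, and the squares add up
    to [(d + g) |h|^2 t^2]. *)
Lemma taylor2_harmonic f p b c d e g : taylor2 f p b c d e g -> d + g = 0 ->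
  harmonic_at f p.
Proof.
move=> tf dg h eps eps0.
have := expansionD (taylor2_line (h1 := h.1) (h2 := h.2) tf) (taylor2_line (h1 := (- h.1)) (h2 := (- h.2)) tf).
move=> /expansionD/(_ (taylor2_line (h1 := (- h.2)) (h2 := h.1) tf)).
move=> /expansionD/(_ (taylor2_line (h1 := h.2) (h2 := (- h.1)) tf)).
set B := (X in expansion _ X _); set D := (X in expansion _ _ X).
have -> : B = 0 by rewrite /B; ring.
have -> : D = 0.
  rewrite /D (_ : g = - d); last by lra.
  by field.
move=> /cvgrPdist_le/(_ _ eps0) H; near=> t.
have t0 : 0 < t by near: t; exact: nbhs_right_gt.
rewrite -ler_pdivrMr ?exprn_gt0// -[X in _ / X](ger0_norm (sqr_ge0 t)) -normf_div.
rewrite -normrN -[X in `|X|]add0r.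
have -> : 0 - cross_sum f p h t / t ^+ 2 = 0 - (f (p.1 + t * h.1, p.2 + t * h.2) - f p + (f (p.1 + t * - h.1, p.2 + t * - h.2) - f p) +
       (f (p.1 + t * - h.2, p.2 + t * h.1) - f p) + (f (p.1 + t * h.2, p.2 + t * - h.1) - f p) -
       0 * t) / t ^+ 2.
  by rewrite /cross_sum !mulrN; congr (_ - _ / _); ring.
by near: t; exact: H.
Unshelve. all: by end_near. Qed.

(** The quadratic terms are even and cancel; the two remainders add up to at most [2 x^2], which is
    below [eps * x] once [x < eps / 2]. *)
Lemma taylor2_odd_derivative f b c d e g : taylor2 f (0, 0) b c d e g ->
  odd_derivative f b c.
Proof.
move=> tf eps eps0.
pose K := `|d| + `|e| + `|g| + 1.
have K0 : 0 < K by rewrite ltr_wpDl// !addr_ge0.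
have /(tf _)/nbhs_ballP[r /= r0 rP] : 0 < (1 : R) by [].
near=> x => t.
have x0 : 0 < x by near: x; exact: nbhs_right_gt.
have xr : x < r by near: x; exact: nbhs_right_lt.
have bnd (u v : R) : `|u| <= 1 -> `|v| <= 1 -> `|f (x * u, x * v) - f (0, 0)
    - x * (b * u + c * v) - x ^+ 2 * (d * u ^+ 2 + 2 * e * (u * v) + g * v ^+ 2) / 2|
    <= x ^+ 2 * (u ^+ 2 + v ^+ 2).
  move=> u1 v1.
  have xu w : `|w| <= 1 -> `|x * w| < r.
    move=> w1; rewrite normrM gtr0_norm//; apply: le_lt_trans xr.
    by rewrite ler_piMr// ltW.
  have := rP (x * u, x * v).
  rewrite /= !add0r => /(_ _)/wrap[].
    by split; rewrite /ball/= sub0r normrN xu.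
  rewrite mul1r; congr (`|_| <= _); last by ring.
  by field.
have c1 := cos_max t; have s1 := sin_max t.
have := bnd _ _ c1 s1; have := bnd (- cos t) (- sin t).
rewrite !normrN => /(_ c1 s1).
rewrite !(mulrN, mulNr, sqrrN, opprK) cos2Dsin2 mulr1.
set A := f (_, _); set A' := f (_, _); set q := d * _ + _ + _.
move=> H1 H2.
have E : A - A' - 2 * x * (b * cos t + c * sin t) =
  (A - f (0, 0) - x * (b * cos t + c * sin t) - x ^+ 2 * q / 2)
  - (A' - f (0, 0) - x * (- (b * cos t) - c * sin t) - x ^+ 2 * q / 2) by field.
rewrite E; apply: le_trans (ler_normB _ _) _.
have x2 : x ^+ 2 + x ^+ 2 <= eps * x.
  have : x < eps / 2 by near: x; apply: nbhs_right_lt; lra.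
  by nra.
by lra.
Unshelve. all: by end_near. Qed.

End Taylor.

(** * Taylor expansions from continuous partial derivatives *)

Section Partials.
Variable R : realType.
Implicit Types (f : R * R -> R) (p q : R * R).

Definition has_partials f fx fy p :=
  is_derive p e1 f (fx p) /\ is_derive p e2 f (fy p).

Lemma is_derive_fst f p a : is_derive p e1 f a ->
  is_derive p.1 1 (fun t => f (t, p.2)) a.
Proof.
case: p => x y [df <-]; have E : (fun h : R => h^-1 *: (((fun t => f (t, y)) \o shift x) (h *: 1) - f (x, y)))
   = (fun h : R => h^-1 *: ((f \o shift (x, y)) (h *: e1) - f (x, y))).
  apply/funext => h; congr (_ *: (f _ - _)); rewrite /e1.
  by apply: injective_projections; rewrite /= ?scaler0 ?add0r.
by split; rewrite /derivable /derive /= E.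
Qed.

Lemma is_derive_snd f p a : is_derive p e2 f a ->
  is_derive p.2 1 (fun t => f (p.1, t)) a.
Proof.
case: p => x y [df <-]; have E : (fun h : R => h^-1 *: (((fun t => f (x, t)) \o shift y) (h *: 1) - f (x, y)))
   = (fun h : R => h^-1 *: ((f \o shift (x, y)) (h *: e2) - f (x, y))).
  apply/funext => h; congr (_ *: (f _ - _)); rewrite /e2.
  by apply: injective_projections; rewrite /= ?scaler0 ?add0r.
by split; rewrite /derivable /derive /= E.
Qed.

Lemma mvt_bound (u du : R -> R) (a b K : R) :
  (forall t, `|t - a| <= `|b - a| -> is_derive t 1 u (du t)) ->
  (forall t, `|t - a| <= `|b - a| -> `|du t| <= K) ->
  `|u b - u a| <= K * `|b - a|.
Proof.
move=> Du Ku.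
suff [c cab ->] : exists2 c, `|c - a| <= `|b - a| & u b - u a = du c * (b - a).
  by rewrite normrM ler_wpM2r ?Ku.
have cont (I : interval R) : (forall t, t \in I -> `|t - a| <= `|b - a|) ->
    {within [set` I], continuous u}.
  move=> HI; apply: continuous_subspace_itv => t /HI /Du Dt.
  by apply/differentiable_continuous/derivable1_diffP; exact: ex_derive.
have /orP[ab|ba] : (a <= b) || (b < a) by case: leP.
  have H t : a <= t <= b -> `|t - a| <= `|b - a|.
    by move=> /andP[at_ tb]; rewrite !ger0_norm ?subr_ge0//; lra.
  have [||c cab E] := @MVT_segment R u du a b ab.
  - by move=> t; rewrite in_itv/= => /andP[/ltW ? /ltW ?]; apply/Du/H/andP.
  - by apply: cont => t; rewrite in_itv/=; exact: H.
  by exists c => //; apply: H; move: cab; rewrite in_itv.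
have H t : b <= t <= a -> `|t - a| <= `|b - a|.
  by move=> /andP[at_ tb]; rewrite !ler0_norm ?subr_le0//; lra.
have [||c cab E] := @MVT_segment R u du b a (ltW ba).
- by move=> t; rewrite in_itv/= => /andP[/ltW ? /ltW ?]; apply/Du/H/andP.
- by apply: cont => t; rewrite in_itv/=; exact: H.
exists c; first by apply: H; move: cab; rewrite in_itv.
by rewrite -opprB E -mulrN opprB.
Qed.

(** The mean value bound for [u] minus its quadratic model. With [B = 0] it serves first-order
    expansions, with general [B] second-order ones. *)
Lemma mvt_bound_quadratic (u du : R -> R) (a b A B K : R) :
  (forall t, `|t - a| <= `|b - a| -> is_derive t 1 u (du t)) ->
  (forall t, `|t - a| <= `|b - a| -> `|du t - A - B * (t - a)| <= K) ->
  `|u b - u a - A * (b - a) - B * (b - a) ^+ 2 / 2| <= K * `|b - a|.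
Proof.
move=> Du Ku.
pose v t := u t - (A * (t - a) + B / 2 * (t - a) ^+ 2).
have := @mvt_bound v (fun t => du t - A - B * (t - a)) a b K _ Ku.
rewrite (_ : v b - v a = u b - u a - A * (b - a) - B * (b - a) ^+ 2 / 2); last by rewrite /v; field.
apply => t /Du Dt.
have -> : v = u - (A *: (id - cst a) + (B / 2) *: (id - cst a) ^+ 2).
  by apply/funext => x; rewrite /v !fctE.
have D0 : is_derive t (1 : R) ((id - cst a) : R -> R) 1.
  by have := is_deriveB (is_derive_id t (1 : R)) (is_derive_cst a t (1 : R)); rewrite subr0.
have D3 := is_deriveB Dt (is_deriveD (is_deriveZ A D0)
  (is_deriveZ (B / 2) (is_deriveX 2 D0))).
by apply: (is_derive_eq D3); rewrite /GRing.scale/= !fctE expr1; field.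
Qed.

Definition taylor1 f p (b c : R) := forall eps, 0 < eps ->
  \forall h \near ((0, 0) : R * R),
  `|f (p.1 + h.1, p.2 + h.2) - f p - (b * h.1 + c * h.2)| <= eps * (`|h.1| + `|h.2|).

Lemma near_square p (P : R * R -> Prop) : (\forall q \near p, P q) ->
  exists2 r, 0 < r & forall q, `|q.1 - p.1| < r -> `|q.2 - p.2| < r -> P q.
Proof.
move=> /nbhs_ballP[r /= r0 rP]; exists r => // q q1 q2; apply: rP.
by split; rewrite /ball/= distrC.
Qed.

Lemma near_zero_square r : 0 < r ->
  \forall h \near ((0, 0) : R * R), `|h.1| < r /\ `|h.2| < r.
Proof.
move=> r0; apply/nbhs_ballP; exists r => //= h [] /=.
by rewrite /ball/= !sub0r !normrN.
Qed.

(** Go from [p] to [p + h] in two legs parallel to the axes and apply the mean value bound on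
    each. *)
Lemma taylor1_partials f fx fy p : (\forall q \near p, has_partials f fx fy q) ->
  {for p, continuous fx} -> {for p, continuous fy} -> taylor1 f p (fx p) (fy p).
Proof.
move=> Df cx cy eps eps0.
have /cvgrPdist_le/(_ _ eps0) cx' := cx; have /cvgrPdist_le/(_ _ eps0) cy' := cy.
have [r r0 rP] := near_square (filterI Df (filterI cx' cy')).
apply: filterS (near_zero_square r0) => -[h1 h2] /= [hr1 hr2].
have A : `|f (p.1 + h1, p.2 + h2) - f (p.1, p.2 + h2) - fx p * h1| <= eps * `|h1|.
  have := @mvt_bound_quadratic (fun t => f (t, p.2 + h2)) (fun t => fx (t, p.2 + h2))
    p.1 (p.1 + h1) (fx p) 0 eps.
  have in_nbhs t : `|t - p.1| <= `|h1| -> has_partials f fx fy (t, p.2 + h2)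
      /\ `|fx p - fx (t, p.2 + h2)| <= eps.
    move=> th; have [||? []//] := rP (t, p.2 + h2) => /=; first exact: le_lt_trans hr1.
    by rewrite addrC addKr.
  rewrite (addrC p.1) addrK !mul0r subr0; apply => t /in_nbhs[[dx _] cxt].
    exact: is_derive_fst dx.
  by rewrite mul0r subr0 distrC.
have B : `|f (p.1, p.2 + h2) - f p - fy p * h2| <= eps * `|h2|.
  have := @mvt_bound_quadratic (fun t => f (p.1, t)) (fun t => fy (p.1, t))
    p.2 (p.2 + h2) (fy p) 0 eps.
  have in_nbhs t : `|t - p.2| <= `|h2| -> has_partials f fx fy (p.1, t)
      /\ `|fy p - fy (p.1, t)| <= eps.
    move=> th; have [||? []//] := rP (p.1, t) => /=; last exact: le_lt_trans hr2.
    by rewrite subrr normr0.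
  rewrite (addrC p.2) addrK !mul0r subr0 -surjective_pairing; apply => t /in_nbhs[[_ dy] cyt].
    exact: is_derive_snd dy.
  by rewrite mul0r subr0 distrC.
rewrite (_ : _ - _ = (f (p.1 + h1, p.2 + h2) - f (p.1, p.2 + h2) - fx p * h1)
  + (f (p.1, p.2 + h2) - f p - fy p * h2)); last by ring.
by apply: le_trans (ler_normD _ _) _; lra.
Qed.

(** The horizontal leg runs at height [p.2 + h2], where [fx] has already changed by about
    [fxy * h2]. So the mixed term is [fxy], and [fyx] never enters; this asymmetry is what [schwarz]
    exploits. *)
Lemma taylor2_partials f fx fy p (fxx fxy fyx fyy : R) :
  (\forall q \near p, has_partials f fx fy q) ->
  taylor1 fx p fxx fxy -> taylor1 fy p fyx fyy ->
  taylor2 f p (fx p) (fy p) fxx fxy fyy.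
Proof.
move=> Df tx ty eps eps0; have e2 : 0 < eps / 2 by lra.
have [r1 r10 r1P] := near_square Df.
have [r2 r20 r2P] := near_square (filterI (tx _ e2) (ty _ e2)).
have r0 : 0 < Num.min r1 r2 by rewrite lt_min r10 r20.
apply: filterS (near_zero_square r0) => -[h1 h2] /=; rewrite !lt_min.
move=> [/andP[a1 a2] /andP[b1 b2]].
have A : `|f (p.1 + h1, p.2 + h2) - f (p.1, p.2 + h2) - (fx p + fxy * h2) * h1
    - fxx * h1 ^+ 2 / 2| <= (eps / 2 * (`|h1| + `|h2|)) * `|h1|.
  have := @mvt_bound_quadratic (fun t => f (t, p.2 + h2)) (fun t => fx (t, p.2 + h2))
    p.1 (p.1 + h1) (fx p + fxy * h2) fxx (eps / 2 * (`|h1| + `|h2|)).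
  rewrite (addrC p.1) addrK; apply => t th.
    have [dx _] : has_partials f fx fy (t, p.2 + h2).
      apply: r1P => /=; first exact: le_lt_trans a1.
      by rewrite addrC addKr.
    exact: is_derive_fst dx.
  have [] := r2P (t - p.1, h2); rewrite /= ?subr0//; first exact: le_lt_trans a2.
  rewrite [p.1 + _]addrC subrK => H _.
  rewrite (_ : _ - _ = fx (t, p.2 + h2) - fx p - (fxx * (t - p.1) + fxy * h2)); last by ring.
  by apply: le_trans H _; rewrite ler_wpM2l ?(ltW e2)// lerD2r.
have B : `|f (p.1, p.2 + h2) - f p - fy p * h2 - fyy * h2 ^+ 2 / 2|
    <= (eps / 2 * `|h2|) * `|h2|.
  have := @mvt_bound_quadratic (fun t => f (p.1, t)) (fun t => fy (p.1, t))
    p.2 (p.2 + h2) (fy p) fyy (eps / 2 * `|h2|).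
  rewrite (addrC p.2) addrK -surjective_pairing; apply => t th.
    have [_ dy] : has_partials f fx fy (p.1, t).
      by apply: r1P; rewrite /= ?subrr ?normr0//; exact: le_lt_trans b1.
    exact: is_derive_snd dy.
  have [] := r2P (0, t - p.2); rewrite /= ?subr0 ?normr0//; first exact: le_lt_trans b2.
  rewrite addr0 [p.2 + _]addrC subrK !mulr0 !add0r => _ H.
  apply: le_trans H _.
  by rewrite ler_wpM2l ?(ltW e2).
rewrite (_ : _ - _ = (f (p.1 + h1, p.2 + h2) - f (p.1, p.2 + h2) - (fx p + fxy * h2) * h1
    - fxx * h1 ^+ 2 / 2) + (f (p.1, p.2 + h2) - f p - fy p * h2 - fyy * h2 ^+ 2 / 2)); last by field.
apply: le_trans (ler_normD _ _) _; apply: le_trans (lerD A B) _.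
rewrite -(real_normK (num_real h1)) -(real_normK (num_real h2)).
set u := `|h1|; set v := `|h2|; have eps0' := ltW eps0.
have := mulr_ge0 eps0' (sqr_ge0 (u - v)).
have := mulr_ge0 eps0' (sqr_ge0 u); have := mulr_ge0 eps0' (sqr_ge0 v); lra.
Qed.

Lemma has_partials_swap f fx fy p : has_partials f fx fy p ->
  has_partials (fun q => f (q.2, q.1)) (fun q => fy (q.2, q.1)) (fun q => fx (q.2, q.1))
    (p.2, p.1).
Proof.
have E v a : is_derive p v f a -> is_derive (p.2, p.1) (v.2, v.1) (fun q => f (q.2, q.1)) a.
  case: p v => x y [v1 v2] [df <-] /=.
  have E : (fun h : R => h^-1 *: (((fun q => f (q.2, q.1)) \o shift (y, x)) (h *: (v2, v1)) - f (x, y)))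
    = (fun h : R => h^-1 *: ((f \o shift (x, y)) (h *: (v1, v2)) - f (x, y))).
    by apply/funext => h; congr (_ *: (f _ - _)); apply: injective_projections.
  by split; rewrite /derivable /derive /= E.
by move=> [/E dx /E dy]; split; rewrite /= -surjective_pairing.
Qed.

Lemma near_swap p (P : R * R -> Prop) : (\forall q \near p, P q) ->
  \forall q \near (p.2, p.1), P (q.2, q.1).
Proof.
move=> /near_square[r r0 rP]; apply/nbhs_ballP; exists r => //= q [] /=.
by rewrite /ball/= => q1 q2; apply: rP; rewrite distrC.
Qed.

Lemma taylor1_swap f p b c : taylor1 f p b c ->
  taylor1 (fun q => f (q.2, q.1)) (p.2, p.1) c b.
Proof.
move=> tf eps eps0; have := near_swap (tf eps eps0); apply: filterS => h /=.
by rewrite -surjective_pairing [in X in _ <= X]addrC [c * _ + _]addrC.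
Qed.

Lemma taylor2_swap f p (b c d e g : R) :
  taylor2 (fun q => f (q.2, q.1)) (p.2, p.1) b c d e g -> taylor2 f p c b g e d.
Proof.
move=> tf eps eps0; have := near_swap (tf eps eps0); apply: filterS => h /=.
by rewrite -!surjective_pairing; congr (`|_| <= _); [field|ring].
Qed.

(* The two orders of the increments give Taylor expansions with either mixed
   derivative, which agree by uniqueness of the expansion. *)
Lemma schwarz f fx fy p (fxx fxy fyx fyy : R) :
  (\forall q \near p, has_partials f fx fy q) ->
  taylor1 fx p fxx fxy -> taylor1 fy p fyx fyy -> fxy = fyx.
Proof.
move=> Df tx ty; have t1 := taylor2_partials Df tx ty.
have Ds : \forall q \near (p.2, p.1), has_partials (fun q => f (q.2, q.1))
    (fun q => fy (q.2, q.1)) (fun q => fx (q.2, q.1)) q.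
  by apply: filterS (near_swap Df) => q /has_partials_swap; rewrite /= -surjective_pairing.
have t2 := taylor2_swap (taylor2_partials Ds (taylor1_swap ty) (taylor1_swap tx)).
by rewrite /= -surjective_pairing in t2; case: (taylor2_unique t1 t2).
Qed.

End Partials.

(** * Vector-valued maps tested against a fixed vector *)

Section VectorCalculus.
Variable R : realType.
Implicit Types (p q v : R * R).

Lemma dotC k (x y : 'rV[R]_k) : dot x y = dot y x.
Proof. by apply: eq_bigr => i _; rewrite mulrC. Qed.

Lemma dotDl k (x y z : 'rV[R]_k) : dot (x + y) z = dot x z + dot y z.
Proof. by rewrite -big_split; apply: eq_bigr => i _; rewrite mxE mulrDl. Qed.

Lemma dotZl k a (x z : 'rV[R]_k) : dot (a *: x) z = a * dot x z.
Proof. by rewrite /dot mulr_sumr; apply: eq_bigr => i _; rewrite mxE mulrA. Qed.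

Lemma dotDr k (x y z : 'rV[R]_k) : dot z (x + y) = dot z x + dot z y.
Proof. by rewrite dotC dotDl !(dotC z). Qed.

Lemma dotZr k a (x z : 'rV[R]_k) : dot z (a *: x) = a * dot z x.
Proof. by rewrite dotC dotZl dotC. Qed.

Lemma dot_ge0 k (x : 'rV[R]_k) : 0 <= dot x x.
Proof. by apply: sumr_ge0 => i _; rewrite -expr2 sqr_ge0. Qed.

Lemma dot_delta k (x : 'rV[R]_k) i : dot x (delta_mx 0 i) = x 0 i.
Proof.
rewrite /dot (bigD1 i)//= big1 ?addr0 ?mxE ?eqxx ?mulr1// => j /negbTE ji.
by rewrite mxE eqxx ji mulr0.
Qed.

Lemma sqr_coord_le_dot k (x : 'rV[R]_k) i : x 0 i ^+ 2 <= dot x x.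
Proof.
rewrite /dot (bigD1 i)//= -expr2 lerDl sumr_ge0// => j _.
by rewrite -expr2 sqr_ge0.
Qed.

Lemma enorm_sqr k (x : 'rV[R]_k) : enorm x ^+ 2 = dot x x.
Proof. by rewrite sqr_sqrtr// dot_ge0. Qed.

Lemma dot_row_mx m n (x1 x2 : 'rV[R]_m) (y1 y2 : 'rV[R]_n) :
  dot (row_mx x1 y1) (row_mx x2 y2) = dot x1 x2 + dot y1 y2.
Proof.
rewrite /dot big_split_ord/=; congr (_ + _); apply: eq_bigr => i _.
  by rewrite !row_mxEl.
by rewrite !row_mxEr.
Qed.

Lemma is_derive_dot k (X Y : R * R -> 'rV[R]_k) p v :
  derivable X p v -> derivable Y p v ->
  is_derive p v (fun q => dot (X q) (Y q)) (dot ('D_v X p) (Y p) + dot (X p) ('D_v Y p)).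
Proof.
move=> dX dY.
have -> : (fun q => dot (X q) (Y q)) = \sum_(i < k) ((fun q => X q 0 i) * (fun q => Y q 0 i)).
  by apply/funext => q; rewrite fct_sumE.
have dXi := (derivable_mxP _ _ _).1 dX; have dYi := (derivable_mxP _ _ _).1 dY.
have DX i : 'D_v (fun q => X q 0 i) p = 'D_v X p 0 i by rewrite (derive_mx dX) mxE.
have DY i : 'D_v (fun q => Y q 0 i) p = 'D_v Y p 0 i by rewrite (derive_mx dY) mxE.
have D i : is_derive p v ((fun q => X q 0 i) * (fun q => Y q 0 i))
    (X p 0 i *: 'D_v (fun q => Y q 0 i) p + Y p 0 i *: 'D_v (fun q => X q 0 i) p).
  by apply: is_deriveM; apply: derivableP.
apply: (is_derive_eq (is_derive_sum D)).
rewrite /dot -big_split; apply: eq_bigr => i _ /=.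
by rewrite DX DY /GRing.scale/= addrC (mulrC (Y p 0 i)).
Qed.

Lemma is_derive_dotl k (X : R * R -> 'rV[R]_k) (nu : 'rV[R]_k) p v :
  derivable X p v -> is_derive p v (fun q => dot (X q) nu) (dot ('D_v X p) nu).
Proof.
move=> dX; have := is_derive_dot dX (derivable_cst nu p v).
rewrite derive_cst; congr is_derive.
by rewrite [X in _ + X]big1 ?addr0// => i _; rewrite mxE mulr0.
Qed.

Lemma continuous_dotl k (Y : R * R -> 'rV[R]_k) (nu : 'rV[R]_k) p :
  {for p, continuous Y} -> {for p, continuous (fun q => dot (Y q) nu)}.
Proof.
move=> cY; rewrite /dot.
have -> : (fun q => \sum_i Y q 0 i * nu 0 i) = \sum_i (fun q => Y q 0 i * nu 0 i).
  by apply/funext => q; rewrite fct_sumE.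
apply: (big_ind (fun f : R * R -> R => {for p, continuous f})).
- exact: cst_continuous.
- by move=> f g cf cg; exact: continuousD.
- move=> i _; apply: continuousM; last exact: cst_continuous.
  by apply: (@continuous_comp _ _ _ Y (fun M : 'rV[R]_k => M 0 i)) => //; exact: coord_continuous.
Qed.

Section C2.
Variables (k : nat) (U : set (R * R)) (X : R * R -> 'rV[R]_k).
Hypotheses (oU : open U) (C2 : C2_on U X).

Let near_U p : U p -> \forall q \near p, U q.
Proof. by move=> Up; apply: open_nbhs_nbhs; split. Qed.

Lemma has_partials_dot nu p : U p ->
  has_partials (fun q => dot (X q) nu) (fun q => dot ('D_e1 X q) nu)
    (fun q => dot ('D_e2 X q) nu) p.
Proof. by case: C2 => C1 _ _ /C1[d1 d2 _ _]; split; exact: is_derive_dotl. Qed.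

Lemma taylor1_partial1_dot nu p : U p -> taylor1 (fun q => dot ('D_e1 X q) nu) p
  (dot ('D_e1 ('D_e1 X) p) nu) (dot ('D_e2 ('D_e1 X) p) nu).
Proof.
case: C2 => _ C1 _ Up; have [_ _ c1 c2] := C1 p Up.
apply: (@taylor1_partials _ _ (fun q => dot ('D_e1 ('D_e1 X) q) nu)
  (fun q => dot ('D_e2 ('D_e1 X) q) nu));
  [|exact: (continuous_dotl c1)|exact: (continuous_dotl c2)].
apply: filterS (near_U Up) => q /C1[d1 d2 _ _].
by split; exact: is_derive_dotl.
Qed.

Lemma taylor1_partial2_dot nu p : U p -> taylor1 (fun q => dot ('D_e2 X q) nu) p
  (dot ('D_e1 ('D_e2 X) p) nu) (dot ('D_e2 ('D_e2 X) p) nu).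
Proof.
case: C2 => _ _ C1 Up; have [_ _ c1 c2] := C1 p Up.
apply: (@taylor1_partials _ _ (fun q => dot ('D_e1 ('D_e2 X) q) nu)
  (fun q => dot ('D_e2 ('D_e2 X) q) nu));
  [|exact: (continuous_dotl c1)|exact: (continuous_dotl c2)].
apply: filterS (near_U Up) => q /C1[d1 d2 _ _].
by split; exact: is_derive_dotl.
Qed.

Lemma taylor2_dot nu p : U p -> taylor2 (fun q => dot (X q) nu) p
  (dot ('D_e1 X p) nu) (dot ('D_e2 X p) nu) (dot ('D_e1 ('D_e1 X) p) nu)
  (dot ('D_e2 ('D_e1 X) p) nu) (dot ('D_e2 ('D_e2 X) p) nu).
Proof.
move=> Up; apply: (taylor2_partials (f := fun q => dot (X q) nu)
  (fx := fun q => dot ('D_e1 X q) nu) (fy := fun q => dot ('D_e2 X q) nu)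
  _ (taylor1_partial1_dot nu Up) (taylor1_partial2_dot nu Up)).
by apply: filterS (near_U Up) => q; exact: has_partials_dot.
Qed.

(** Lets a coordinate [x 0 j] be expanded as it stands, without appearing as an inner product with a
    basis vector. *)
Lemma taylor2_linear_form (ell : 'rV[R]_k -> R) nu p : (forall x, ell x = dot x nu) ->
  U p -> taylor2 (fun q => ell (X q)) p
  (ell ('D_e1 X p)) (ell ('D_e2 X p)) (ell ('D_e1 ('D_e1 X) p))
  (ell ('D_e2 ('D_e1 X) p)) (ell ('D_e2 ('D_e2 X) p)).
Proof.
move=> E; have -> : ell = (fun x => dot x nu) by apply/funext.
exact: taylor2_dot.
Qed.

Lemma schwarz_dot nu p : U p ->
  dot ('D_e2 ('D_e1 X) p) nu = dot ('D_e1 ('D_e2 X) p) nu.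
Proof.
move=> Up; apply: (schwarz (f := fun q => dot (X q) nu)
  (fx := fun q => dot ('D_e1 X q) nu) (fy := fun q => dot ('D_e2 X q) nu)
  _ (taylor1_partial1_dot nu Up) (taylor1_partial2_dot nu Up)).
by apply: filterS (near_U Up) => q; exact: has_partials_dot.
Qed.

End C2.

Lemma taylor1_C1 (U : set (R * R)) (f : R * R -> R) p : open U -> C1_on U f -> U p ->
  taylor1 f p ('D_e1 f p) ('D_e2 f p).
Proof.
move=> oU Cf Up; have near_U : nbhs p U := open_nbhs_nbhs (conj oU Up).
have [_ _ c1 c2] := Cf p Up.
apply: (taylor1_partials (f := f) (fx := 'D_e1 f) (fy := 'D_e2 f) _ c1 c2).
by apply: filterS near_U => q /Cf[d1 d2 _ _]; split; exact: derivableP.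
Qed.

Lemma taylor2_C2 (U : set (R * R)) (f : R * R -> R) p : open U -> C2_on U f -> U p ->
  taylor2 f p ('D_e1 f p) ('D_e2 f p) ('D_e1 ('D_e1 f) p) ('D_e2 ('D_e1 f) p)
    ('D_e2 ('D_e2 f) p).
Proof.
move=> oU [C1 C11 C12] Up; have near_U : nbhs p U := open_nbhs_nbhs (conj oU Up).
apply: (taylor2_partials (f := f) (fx := 'D_e1 f) (fy := 'D_e2 f) _
  (taylor1_C1 oU C11 Up) (taylor1_C1 oU C12 Up)).
by apply: filterS near_U => q /C1[d1 d2 _ _]; split; exact: derivableP.
Qed.

Lemma differentiable_linear_approx (V W : normedModType R) (f : V -> W)
    (df : {linear V -> W}) (x : V) : continuous df ->
  (forall eps : R, 0 < eps ->
    \forall h \near (0 : V), `|f (h + x) - (f x + df h)| <= eps * `|h|) ->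
  differentiable f x.
Proof.
move=> cdf H.
have E : f \o shift x = cst (f x) + df +o_ 0 id by apply/eqaddoP.
by apply/diff_locallyP; rewrite (diff_unique cdf E).
Qed.

(** Bridges [C1_on], which speaks of partial derivatives, and [unit_normal_field], which demands
    Fréchet differentiability. *)
Lemma taylor1_differentiable (f : R * R -> R) p b c : taylor1 f p b c -> differentiable f p.
Proof.
move=> tf; pose L (h : R * R) : R := b * h.1 + c * h.2.
have linL : linear L by move=> a u w; rewrite /L /= /GRing.scale/=; ring.
pose LM := GRing.isLinear.Build _ _ _ _ _ linL.
pose LL : {linear _ -> _} := HB.pack L LM.
have cL : continuous L by rewrite /L; continuity.
apply: (@differentiable_linear_approx _ _ f LL) => // eps eps0.
(* The norm on pairs is the max norm, so [|h.1| + |h.2|] is at most twice the norm of [h]. *)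
have e2 : 0 < eps / 2 by rewrite divr_gt0.
apply: filterS (tf _ e2) => h /=.
have -> : (f (h + p) - (f p + L h)) = f (p.1 + h.1, p.2 + h.2) - f p - L h.
  rewrite opprD addrA; congr (f _ - _ - _).
  by apply: injective_projections; rewrite /= addrC.
move=> H; apply: le_trans H _.
have -> : eps * `|h| = eps / 2 * (`|h| + `|h|) by field.
rewrite ler_wpM2l ?(ltW e2)// lerD//.
  by rewrite prod_normE le_max lexx.
by rewrite prod_normE le_max lexx orbT.
Qed.

End VectorCalculus.

(** * Minimal graphs in conformal parameters *)

Section Graph.
Variables (R : realType) (m : nat).
Implicit Types (p q v a : R * R) (c : 'I_m -> R).

(** The common shape of [graph phi p], its derivatives and the normals: [graph phi p] is convertible
    to [gvec p (phi ^~ p)]. *)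
Definition gvec a c : 'rV[R]_(2 + m) :=
  row_mx (\row_(i < 2) (if i == 0 then a.1 else a.2)) (\row_s c s).

Lemma dot_gvec a c a' c' :
  dot (gvec a c) (gvec a' c') = a.1 * a'.1 + a.2 * a'.2 + \sum_s c s * c' s.
Proof.
rewrite dot_row_mx; congr (_ + _).
  by rewrite /dot !big_ord_recl big_ord0 !mxE/= addr0.
by apply: eq_bigr => s _; rewrite !mxE.
Qed.

Lemma gvecD a c a' c' : gvec a c + gvec a' c' =
  gvec (a.1 + a'.1, a.2 + a'.2) (fun s => c s + c' s).
Proof.
rewrite /gvec add_row_mx; congr row_mx; apply/rowP => i; rewrite !mxE//.
by case: ifP.
Qed.

Lemma gvecZ (k : R) a c : k *: gvec a c = gvec (k * a.1, k * a.2) (fun s => k * c s).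
Proof.
rewrite /gvec scale_row_mx; congr row_mx; apply/rowP => i; rewrite !mxE//.
by case: ifP.
Qed.

Lemma is_derive_fst_coord p v : is_derive p v (fun q : R * R => q.1) v.1.
Proof.
have E : (fun h : R => h^-1 *: (((fun q : R * R => q.1) \o shift p) (h *: v) - p.1)) @ 0^' --> v.1.
  apply: (@cvg_eq_near _ _ _ _ (fun=> v.1)); last exact: cvg_cst.
  near=> h; rewrite /= addrK scalerA mulVf ?scale1r//; near: h; exact: nbhs_dnbhs_neq.
by split; [exact: cvgP E|exact: cvg_lim E].
Unshelve. all: by end_near. Qed.

Lemma is_derive_snd_coord p v : is_derive p v (fun q : R * R => q.2) v.2.
Proof.
have E : (fun h : R => h^-1 *: (((fun q : R * R => q.2) \o shift p) (h *: v) - p.2)) @ 0^' --> v.2.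
  apply: (@cvg_eq_near _ _ _ _ (fun=> v.2)); last exact: cvg_cst.
  near=> h; rewrite /= addrK scalerA mulVf ?scale1r//; near: h; exact: nbhs_dnbhs_neq.
by split; [exact: cvgP E|exact: cvg_lim E].
Unshelve. all: by end_near. Qed.

Lemma is_derive_gvec (a1 a2 : R * R -> R) (c : 'I_m -> R * R -> R) p v da dc :
  is_derive p v a1 da.1 -> is_derive p v a2 da.2 ->
  (forall s, is_derive p v (c s) (dc s)) ->
  is_derive p v (fun q => gvec (a1 q, a2 q) (c ^~ q)) (gvec da dc).
Proof.
move=> D1 D2 Dc.
have D i j : is_derive p v (fun q => gvec (a1 q, a2 q) (c ^~ q) i j) (gvec da dc i j).
  rewrite (ord1 i); case: (split_ordP j) => k ->.
    rewrite /gvec row_mxEl mxE.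
    have -> : (fun q => row_mx (\row_(i < 2) (if i == 0 then (a1 q, a2 q).1 else (a1 q, a2 q).2))
        (\row_s c s q) 0 (lshift m k)) = if k == 0 then a1 else a2.
      by apply/funext => q; rewrite row_mxEl mxE; case: ifP.
    by case: ifP.
  rewrite /gvec row_mxEr mxE.
  have -> : (fun q => row_mx (\row_(i < 2) (if i == 0 then (a1 q, a2 q).1 else (a1 q, a2 q).2))
      (\row_s c s q) 0 (rshift 2 k)) = c k.
    by apply/funext => q; rewrite row_mxEr mxE.
  exact: Dc.
have Dg : derivable (fun q => gvec (a1 q, a2 q) (c ^~ q)) p v.
  by apply/derivable_mxP => i j; have [] := D i j.
split => //; apply/matrixP => i j; rewrite (derive_mx Dg) mxE.
by have [_ ->] := D i j.
Qed.

Variables (U : set (R * R)) (phi : 'I_m -> R * R -> R).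
Hypotheses (oU : open U) (C2phi : forall s, C2_on U (phi s)).

Lemma derive_graph p v : U p -> v = e1 \/ v = e2 ->
  'D_v (graph phi) p = gvec v (fun s => 'D_v (phi s) p).
Proof.
move=> Up vE; have : is_derive p v (fun q => gvec (q.1, q.2) (phi ^~ q))
    (gvec v (fun s => 'D_v (phi s) p)).
  apply: is_derive_gvec; first exact: is_derive_fst_coord.
    exact: is_derive_snd_coord.
  move=> s; have [C1 _ _] := C2phi s; have [d1 d2 _ _] := C1 p Up.
  by case: vE => ->; exact: derivableP.
have -> : (fun q => gvec (q.1, q.2) (phi ^~ q)) = graph phi by [].
by case.
Qed.

Lemma derive2_graph p v w : U p -> v = e1 \/ v = e2 -> w = e1 \/ w = e2 ->
  'D_w ('D_v (graph phi)) p = gvec (0, 0) (fun s => 'D_w ('D_v (phi s)) p).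
Proof.
move=> Up vE wE; have near_U : nbhs p U := open_nbhs_nbhs (conj oU Up).
have E : \forall q \near p, gvec (v.1, v.2) (fun s => 'D_v (phi s) q) = 'D_v (graph phi) q.
  by apply: filterS near_U => q Uq; rewrite derive_graph// -surjective_pairing.
rewrite -(near_eq_derive w E).
have : is_derive p w (fun q => gvec ((fun=> v.1) q, (fun=> v.2) q) (fun s => 'D_v (phi s) q))
    (gvec (0, 0) (fun s => 'D_w ('D_v (phi s)) p)).
  apply: (is_derive_gvec (c := fun s q => 'D_v (phi s) q)).
  move=> s; have [_ C1 C1'] := C2phi s.
  have [d11 d12 _ _] := C1 p Up; have [d21 d22 _ _] := C1' p Up.
  by case: vE wE => -> [->|->]; exact: derivableP.
by case.
Qed.

Definition normal_length s p : R := Num.sqrt (1 + 'D_e1 (phi s) p ^+ 2 + 'D_e2 (phi s) p ^+ 2).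

(** The second derivatives of the graph have zero plane part, so pairing them with this normal
    isolates those of [phi s]. Normals with different [s] need not be orthogonal to each other. *)
Definition coord_normal s p : 'rV[R]_(2 + m) :=
  (normal_length s p)^-1 *: gvec (- 'D_e1 (phi s) p, - 'D_e2 (phi s) p) (fun t => (t == s)%:R).

Lemma normal_length_gt0 s p : 0 < normal_length s p.
Proof. by rewrite sqrtr_gt0 -addrA ltr_pwDl// addr_ge0 ?sqr_ge0. Qed.

Lemma sum_delta c s : \sum_t (t == s)%:R * c t = c s.
Proof.
rewrite (bigD1 s)//= eqxx mul1r big1 ?addr0// => t /negbTE ->.
by rewrite mul0r.
Qed.

Lemma unit_normal_coord_normal s : unit_normal_field U (graph phi) (coord_normal s).
Proof.
move=> p Up; have [C1 C11 C12] := C2phi s.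
have d1 : differentiable ('D_e1 (phi s)) p.
  exact: (taylor1_differentiable (taylor1_C1 oU C11 Up)).
have d2 : differentiable ('D_e2 (phi s)) p.
  exact: (taylor1_differentiable (taylor1_C1 oU C12 Up)).
have l0 := normal_length_gt0 s p.
have dl : differentiable (fun q => (normal_length s q)^-1) p.
  apply: differentiableV; last by rewrite gt_eqF.
  pose u : R * R -> R := cst 1 + 'D_e1 (phi s) ^+ 2 + 'D_e2 (phi s) ^+ 2.
  have up : 0 < u p by rewrite /u !fctE -addrA ltr_pwDl// addr_ge0 ?sqr_ge0.
  have -> : normal_length s = Num.sqrt \o u by apply/funext => q; rewrite /u /normal_length /= !fctE.
  apply: differentiable_comp.
    by apply: differentiableD; [apply: differentiableD|]; rewrite //; exact: differentiableX.
  by apply/derivable1_diffP; have [] := is_derive1_sqrt up.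
split.
(* Differentiability is checked on a sum of scalar functions times constant vectors. *)
- have -> : coord_normal s = (fun q => ((normal_length s q)^-1 * - 'D_e1 (phi s) q) *: gvec e1 (fun=> 0))
     + (fun q => ((normal_length s q)^-1 * - 'D_e2 (phi s) q) *: gvec e2 (fun=> 0))
     + (fun q => (normal_length s q)^-1 *: gvec (0, 0) (fun t => (t == s)%:R)).
    apply/funext => q; rewrite /coord_normal !fctE -!scalerA -!scalerDr; congr (_ *: _).
    rewrite !gvecZ !gvecD /=; congr (gvec (_, _) _); try ring.
    by apply/funext => t; ring.
  apply: differentiableD; first apply: differentiableD; apply: differentiableZl => //.
  + by apply: differentiableM => //; exact: differentiableN.
  + by apply: differentiableM => //; exact: differentiableN.
- rewrite /enorm /coord_normal dotZl dotZr dot_gvec sum_delta eqxx/=.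
  rewrite [X in Num.sqrt X](_ : _ = 1) ?sqrtr1// mulrA -invfM -expr2.
  rewrite sqr_sqrtr ?addr_ge0 ?sqr_ge0//.
  rewrite (_ : _ + 1%:R = 1 + 'D_e1 (phi s) p ^+ 2 + 'D_e2 (phi s) p ^+ 2); last by ring.
  by rewrite mulVf// -addrA gt_eqF// ltr_pwDl// addr_ge0 ?sqr_ge0.
- rewrite derive_graph//; last by left.
  rewrite /coord_normal dotZl dot_gvec sum_delta/=; ring.
- rewrite derive_graph//; last by right.
  rewrite /coord_normal dotZl dot_gvec sum_delta/=; ring.
Qed.

End Graph.

Lemma open_disc (R : realType) (a : R) : open (disc a).
Proof.
apply: (@open_comp _ _ (@sqn R) [set x | x < a ^+ 2]); last exact: open_lt.
by move=> p _; exact: continuous_sqn.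
Qed.

(** * Linear algebra in the tangent plane of a graph *)

Section TangentVectors.
Variables (R : realType) (m : nat).

Lemma gvec_coordS a (c : 'I_m -> R) s : gvec a c 0 (rshift 2 s) = c s.
Proof. by rewrite row_mxEr mxE. Qed.

Lemma gvec_eta (x : 'rV[R]_(2 + m)) :
  x = gvec (x 0 0, x 0 1) (fun s => x 0 (rshift 2 s)).
Proof.
apply/rowP => j; case: (split_ordP j) => k ->; last by rewrite gvec_coordS.
rewrite row_mxEl mxE; case: k => -[|[|//]] lk /=.
  by congr (x 0 _); apply/val_inj.
by congr (x 0 _); apply/val_inj => /=; rewrite modn_small.
Qed.

(* [d1 s], [d11 s], ... stand for the derivatives of [phi s]. *)
Variables d1 d2 d11 d12 d22 : 'I_m -> R.

Definition tangent (x : 'rV[R]_(2 + m)) :=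
  forall s, x 0 (rshift 2 s) = d1 s * x 0 0 + d2 s * x 0 1.

Let g11 : R := 1 + \sum_s d1 s ^+ 2.
Let g12 : R := \sum_s d1 s * d2 s.
Let g22 : R := 1 + \sum_s d2 s ^+ 2.

(* The determinant is positive because, up to the factor [g11 >= 1], it is the
   squared length of [g11 Phi_2 - g12 Phi_1], whose second coordinate is [g11]. *)
Lemma gram_det_gt0 : 0 < g11 * g22 - g12 ^+ 2.
Proof.
rewrite /g11 /g12 /g22; set A := \sum_s _; set C := \sum_s _; set B := \sum_s _.
have A0 : 0 <= A by apply: sumr_ge0 => s _; exact: sqr_ge0.
have H : 0 <= \sum_s ((1 + A) * d2 s - B * d1 s) ^+ 2.
  by apply: sumr_ge0 => s _; exact: sqr_ge0.
have E a b : \sum_s (a * d2 s - b * d1 s) ^+ 2 = a ^+ 2 * C - 2 * a * b * B + b ^+ 2 * A.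
  by rewrite /A /B /C !mulr_sumr -sumrN -!big_split/=; apply: eq_bigr => s _; ring.
rewrite E in H.
have : 0 < (1 + A) * ((1 + A) * (1 + C) - B ^+ 2).
  have := sqr_ge0 B; nra.
by rewrite pmulr_rgt0// ltr_pwDl.
Qed.

Lemma dot_tangent x y : tangent x -> tangent y ->
  dot x y = x 0 0 * y 0 0 * g11 + (x 0 0 * y 0 1 + x 0 1 * y 0 0) * g12
    + x 0 1 * y 0 1 * g22.
Proof.
move=> tx ty; rewrite {1}[x]gvec_eta {1}[y]gvec_eta dot_gvec/= /g11 /g12 /g22.
rewrite !mulrDr !mulr1 !mulr_sumr.
rewrite (eq_bigr (fun s => x 0 0 * y 0 0 * d1 s ^+ 2
  + (x 0 0 * y 0 1 + x 0 1 * y 0 0) * (d1 s * d2 s) + x 0 1 * y 0 1 * d2 s ^+ 2)).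
  by rewrite !big_split/=; ring.
by move=> s _; rewrite tx ty; ring.
Qed.

(** Two linear systems are inverted: the Jacobian turns orthogonality to [xu], [xv] into
    orthogonality to the coordinate tangent vectors of the graph, and the Gram matrix then kills the
    plane part of [x]. *)
Lemma tangent_orthogonal_eq0 (xu xv x : 'rV[R]_(2 + m)) : tangent xu -> tangent xv -> tangent x ->
  xu 0 0 * xv 0 1 - xv 0 0 * xu 0 1 != 0 -> dot x xu = 0 -> dot x xv = 0 -> x = 0.
Proof.
move=> tu tv tx; rewrite !dot_tangent//.
set a := xu 0 0; set c := xu 0 1; set b := xv 0 0; set d := xv 0 1 => J.
set P := x 0 0; set Q := x 0 1 => L1 L2.
have D0 : g11 * g22 - g12 ^+ 2 != 0 by rewrite gt_eqF// gram_det_gt0.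
have [P0 Q0] : P = 0 /\ Q = 0.
  move: L1 L2; clearbody a b c d P Q g11 g12 g22 => L1 L2.
  have E1 : P * g11 + Q * g12 = 0.
    apply: (mulfI J); have := congr1 ( *%R d) L1; have := congr1 ( *%R c) L2; lra.
  have E2 : P * g12 + Q * g22 = 0.
    apply: (mulfI J); have := congr1 ( *%R b) L1; have := congr1 ( *%R a) L2; lra.
  split; apply: (mulfI D0).
    have := congr1 ( *%R g22) E1; have := congr1 ( *%R g12) E2; lra.
  have := congr1 ( *%R g12) E1; have := congr1 ( *%R g11) E2; lra.
rewrite [x]gvec_eta -/P -/Q P0 Q0; apply/rowP => j; rewrite [RHS]mxE.
case: (split_ordP j) => k ->; first by rewrite row_mxEl mxE; case: ifP.
by rewrite gvec_coordS tx -/P -/Q P0 Q0 !mulr0 addr0.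
Qed.

(* Conformality says [J^T g J = W I] for the Jacobian [J], that is
   [J J^T = W g^-1]. *)
Lemma conformal_trace (xu xv : 'rV[R]_(2 + m)) (W : R) s : tangent xu -> tangent xv -> W != 0 ->
  dot xu xu = W -> dot xv xv = W -> dot xu xv = 0 ->
  d11 s * g22 - 2 * d12 s * g12 + d22 s * g11 = 0 ->
  (d11 s * xu 0 0 ^+ 2 + 2 * d12 s * (xu 0 0 * xu 0 1) + d22 s * xu 0 1 ^+ 2)
  + (d11 s * xv 0 0 ^+ 2 + 2 * d12 s * (xv 0 0 * xv 0 1) + d22 s * xv 0 1 ^+ 2) = 0.
Proof.
move=> tu tv W0; rewrite !dot_tangent//.
set a := xu 0 0; set c := xu 0 1; set b := xv 0 0; set d := xv 0 1 => c1 c2 c3 M.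
clearbody a b c d g11 g12 g22.
apply: (mulfI W0); rewrite mulr0.
have E22 : W * (a ^+ 2 + b ^+ 2) = (a * d - b * c) ^+ 2 * g22.
  have := congr1 ( *%R (a ^+ 2)) c2; have := congr1 ( *%R (b ^+ 2)) c1.
  have := congr1 ( *%R (2 * a * b)) c3; lra.
have E11 : W * (c ^+ 2 + d ^+ 2) = (a * d - b * c) ^+ 2 * g11.
  have := congr1 ( *%R (c ^+ 2)) c2; have := congr1 ( *%R (d ^+ 2)) c1.
  have := congr1 ( *%R (2 * c * d)) c3; lra.
have E12 : W * (a * c + b * d) = - (a * d - b * c) ^+ 2 * g12.
  have := congr1 ( *%R (a * c)) c2; have := congr1 ( *%R (b * d)) c1.
  have := congr1 ( *%R (a * d + b * c)) c3; lra.
rewrite (_ : W * _ = d11 s * (W * (a ^+ 2 + b ^+ 2)) + 2 * d12 s * (W * (a * c + b * d))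
  + d22 s * (W * (c ^+ 2 + d ^+ 2))); last by ring.
by rewrite E11 E12 E22 -(mulr0 ((a * d - b * c) ^+ 2)) -M; ring.
Qed.

(** Add the second-order chain rule in the directions [(1, 0)] and [(0, 1)]: the Hessian terms of
    [phi s] cancel by [conformal_trace], so the Laplacian is tangent. The last two hypotheses make
    it normal, hence zero. *)
Lemma conformal_laplacian_eq0 (xu xv xuu xuv xvv : 'rV[R]_(2 + m)) (W : R) :
  0 < xu 0 0 * xv 0 1 - xv 0 0 * xu 0 1 ->
  dot xu xu = W -> dot xv xv = W -> dot xu xv = 0 ->
  (forall s, d11 s * g22 - 2 * d12 s * g12 + d22 s * g11 = 0) ->
  (forall s (h1 h2 : R),
    let a j := xu 0 j * h1 + xv 0 j * h2 in
    let d j := (xuu 0 j * h1 ^+ 2 + 2 * xuv 0 j * (h1 * h2) + xvv 0 j * h2 ^+ 2) / 2 in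
    a (rshift 2 s) = d1 s * a 0 + d2 s * a 1 /\
    d (rshift 2 s) = d1 s * d 0 + d2 s * d 1
      + (d11 s * a 0 ^+ 2 + 2 * d12 s * (a 0 * a 1) + d22 s * a 1 ^+ 2) / 2) ->
  dot (xuu + xvv) xu = 0 -> dot (xuu + xvv) xv = 0 -> xuu + xvv = 0.
Proof.
move=> J c1 c2 c3 M chain L1 L2.
have tu : tangent xu.
  by move=> s; have [+ _] := chain s 1 0; rewrite !mulr1 !mulr0 !addr0.
have tv : tangent xv.
  by move=> s; have [+ _] := chain s 0 1; rewrite !mulr1 !mulr0 !add0r.
apply: (tangent_orthogonal_eq0 tu tv) => //; last by rewrite gt_eqF.
have W0 : W != 0.
  apply/eqP => W0; rewrite W0 in c1.
  have Z j : xu 0 j = 0.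
    apply/eqP; rewrite -sqrf_eq0; apply/eqP/le_anti; rewrite sqr_ge0 andbT -c1.
    exact: sqr_coord_le_dot.
  by move: J; rewrite !Z mul0r mulr0 subrr ltxx.
move=> s; have [_ A] := chain s 1 0; have [_ B] := chain s 0 1.
have T := conformal_trace tu tv W0 c1 c2 c3 (M s).
rewrite !mxE; move: A B T; rewrite !(expr1n, expr0n, mulr0, mulr1, mul0r, mul1r, addr0, add0r)/=.
lra.
Qed.

End TangentVectors.

(** * The minimal surface system *)

Section MinimalGraph.
Variables (R : realType) (m : nat) (U : set (R * R)) (phi : 'I_m -> R * R -> R).
Hypotheses (oU : open U) (C2phi : forall s, C2_on U (phi s)).

(** Test minimality with [coord_normal phi s]; the normalizing factor and the denominator of the
    mean curvature are nonzero and drop out. *)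
Lemma minimal_graph_equation s p : minimal U (graph phi) -> U p ->
  'D_e1 ('D_e1 (phi s)) p * (1 + \sum_t 'D_e2 (phi t) p ^+ 2)
  - 2 * 'D_e2 ('D_e1 (phi s)) p * (\sum_t 'D_e1 (phi t) p * 'D_e2 (phi t) p)
  + 'D_e2 ('D_e2 (phi s)) p * (1 + \sum_t 'D_e1 (phi t) p ^+ 2) = 0.
Proof.
move=> hmin Up; have := hmin _ (unit_normal_coord_normal oU C2phi s) p Up.
have D := gram_det_gt0 (fun t => 'D_e1 (phi t) p) (fun t => 'D_e2 (phi t) p).
have G11 : metric (graph phi) e1 e1 p = 1 + \sum_t 'D_e1 (phi t) p ^+ 2.
  rewrite /metric (derive_graph C2phi)//; last by left.
  by rewrite dot_gvec/= mulr1 mulr0 addr0.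
have G22 : metric (graph phi) e2 e2 p = 1 + \sum_t 'D_e2 (phi t) p ^+ 2.
  rewrite /metric (derive_graph C2phi)//; last by right.
  by rewrite dot_gvec/= mulr1 mulr0 add0r.
have G12 : metric (graph phi) e1 e2 p = \sum_t 'D_e1 (phi t) p * 'D_e2 (phi t) p.
  rewrite /metric !(derive_graph C2phi)//; try by [left|right].
  by rewrite dot_gvec/= mulr0 mul0r !add0r.
rewrite /mean_curvature /area_element G11 G12 G22 sqr_sqrtr ?(ltW D)//.
move=> /eqP; rewrite mulf_eq0 invr_eq0 mulf_eq0 (gt_eqF D) orbF pnatr_eq0 orbF => /eqP.
have L v w : v = e1 \/ v = e2 -> w = e1 \/ w = e2 ->
    second_form (graph phi) (coord_normal phi s) v w p
    = (normal_length phi s p)^-1 * 'D_w ('D_v (phi s)) p.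
  move=> vE wE; rewrite /second_form (derive2_graph oU C2phi)// /coord_normal dotZr.
  rewrite dot_gvec/= !mul0r !add0r; congr (_ * _).
  by under eq_bigr do rewrite mulrC; rewrite sum_delta.
rewrite (L e1 e1) ?(L e1 e2) ?(L e2 e2); try by [left|right].
set k := _^-1; have k0 : k != 0 by rewrite invr_eq0 gt_eqF// normal_length_gt0.
have alg (a b c x y z : R) : k * a * x - 2 * (k * b) * y + k * c * z = 0 ->
    a * x - 2 * b * y + c * z = 0.
  by move=> E; apply: (mulfI k0); rewrite mulr0 -[RHS]E; ring.
exact: alg.
Qed.

End MinimalGraph.

(** * Harmonicity of the conformal parametrization *)

Section ConformalGraph.
Variables (R : realType) (m : nat) (r : R) (phi : 'I_m -> R * R -> R).
Variable X : R * R -> 'rV[R]_(2 + m).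
Hypotheses (C2phi : forall s, C2_on (disc r) (phi s)) (hmin : minimal (disc r) (graph phi)).
Hypothesis hX : conformal_parameters r phi X.
Hypothesis plane_map_disc : forall p, disc 1 p -> disc r (plane_map X p).

Lemma taylor2_coord j p : disc 1 p -> taylor2 (fun q => X q 0 j) p
  ('D_e1 X p 0 j) ('D_e2 X p 0 j) ('D_e1 ('D_e1 X) p 0 j)
  ('D_e2 ('D_e1 X) p 0 j) ('D_e2 ('D_e2 X) p 0 j).
Proof.
move=> p1; apply: (taylor2_linear_form (ell := fun x : 'rV[R]_(2 + m) => x 0 j)
  (nu := delta_mx 0 j) (@open_disc R 1) (conf_C2 hX) _ p1).
by move=> x; rewrite dot_delta.
Qed.

Lemma near_disc (a : R) p (h1 h2 : R) : disc a p ->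
  \forall t \near (0 : R)^'+, disc a (p.1 + t * h1, p.2 + t * h2).
Proof.
move=> pa; have c : continuous (fun t : R => (p.1 + t * h1, p.2 + t * h2)) by continuity.
have H := cvg_at_right_filter (c 0); apply: (H (disc a)).
rewrite !mul0r !addr0 -surjective_pairing.
exact: (open_nbhs_nbhs (conj (@open_disc R a) pa)).
Qed.

(** Along [p + t h] the component [2 + s] of [X] has two expansions: its own, and that of [phi s]
    composed with the first two components. Uniqueness equates their coefficients. *)
Lemma conformal_chain p : disc 1 p -> forall s (h1 h2 : R),
  let q := plane_map X p in
  let a j := 'D_e1 X p 0 j * h1 + 'D_e2 X p 0 j * h2 in
  let d j := ('D_e1 ('D_e1 X) p 0 j * h1 ^+ 2 + 2 * 'D_e2 ('D_e1 X) p 0 j * (h1 * h2)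
    + 'D_e2 ('D_e2 X) p 0 j * h2 ^+ 2) / 2 in
  a (rshift 2 s) = 'D_e1 (phi s) q * a 0 + 'D_e2 (phi s) q * a 1 /\
  d (rshift 2 s) = 'D_e1 (phi s) q * d 0 + 'D_e2 (phi s) q * d 1
    + ('D_e1 ('D_e1 (phi s)) q * a 0 ^+ 2 + 2 * 'D_e2 ('D_e1 (phi s)) q * (a 0 * a 1)
       + 'D_e2 ('D_e2 (phi s)) q * a 1 ^+ 2) / 2.
Proof.
move=> p1 s h1 h2 q a d.
have T j := taylor2_line (h1 := h1) (h2 := h2) (taylor2_coord j p1).
have tphi := taylor2_C2 (@open_disc R r) (C2phi s) (plane_map_disc p1).
have C := taylor2_curve tphi (T 0) (T 1).
apply: (expansion_unique (T (rshift 2 s))).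
have Xs w : disc 1 w -> X w 0 (rshift 2 s) = phi s (plane_map X w).
  move=> w1; rewrite (conf_graph hX (subset_closure w1)).
  by rewrite -[graph _ _]/(gvec (plane_map X w) (phi ^~ (plane_map X w))) gvec_coordS.
apply: (expansion_near _ C); near=> t.
have pt : disc 1 (p.1 + t * h1, p.2 + t * h2) by near: t; exact: near_disc.
rewrite !Xs// /plane_map /=; congr (phi s (_, _) - _).
  by rewrite addrC subrK.
by rewrite addrC subrK.
Unshelve. all: by end_near. Qed.

Lemma derive_plane_map v p : derivable X p v ->
  'D_v (plane_map X) p = ('D_v X p 0 0, 'D_v X p 0 1).
Proof.
move=> dX; have dXi := (derivable_mxP _ _ _).1 dX.
rewrite (derive_mx dX) !mxE; apply: cvg_lim => //.
exact: (cvg_pair (dXi 0 0) (dXi 0 1)).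
Qed.

Lemma is_derive_sqr_length_sub k (A B : R * R -> 'rV[R]_k) p v :
  derivable A p v -> derivable B p v ->
  is_derive p v (fun q => dot (A q) (A q) - dot (B q) (B q))
    (dot ('D_v A p) (A p) + dot (A p) ('D_v A p) - (dot ('D_v B p) (B p) + dot (B p) ('D_v B p))).
Proof. by move=> dA dB; exact: (is_deriveB (is_derive_dot dA dA) (is_derive_dot dB dB)). Qed.

Lemma near_zero_derive (f : R * R -> R) p v df : (\forall q \near p, f q = 0) ->
  is_derive p v f df -> df = 0.
Proof.
move=> f0 Df; have [_ <-] := near_eq_is_derive (g := cst 0) f0 Df.
exact: derive_cst.
Qed.

(** With [E = |X_u|^2 - |X_v|^2] and [F = X_u . X_v], both identically zero, the two products are
    [E_u / 2 + F_v] and [F_u - E_v / 2], once the mixed derivatives are identified. *)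
Lemma conformal_orthogonal p : disc 1 p ->
  let L := 'D_e1 ('D_e1 X) p + 'D_e2 ('D_e2 X) p in
  dot L ('D_e1 X p) = 0 /\ dot L ('D_e2 X p) = 0.
Proof.
move=> p1; have near1 : nbhs p (disc 1) := open_nbhs_nbhs (conj (@open_disc R 1) p1).
have [C1 C11 C12] := conf_C2 hX.
have [duu duv _ _] := C11 p p1; have [dvu dvv _ _] := C12 p p1.
have E q : disc 1 q -> dot ('D_e1 X q) ('D_e1 X q) - dot ('D_e2 X q) ('D_e2 X q) = 0.
  have alg (x y : 'rV[R]_(2 + m)) w : enorm x ^+ 2 = w -> enorm y ^+ 2 = w ->
      dot x x - dot y y = 0.
    by rewrite !enorm_sqr => -> ->; rewrite subrr.
  by move=> /(conf_conformal hX)[c1 c2 _]; exact (alg _ _ _ c1 c2).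
have F q : disc 1 q -> dot ('D_e1 X q) ('D_e2 X q) = 0.
  by move=> /(conf_conformal hX)[].
have DE v : derivable ('D_e1 X) p v -> derivable ('D_e2 X) p v ->
    (dot ('D_v ('D_e1 X) p) ('D_e1 X p) + dot ('D_e1 X p) ('D_v ('D_e1 X) p))
    - (dot ('D_v ('D_e2 X) p) ('D_e2 X p) + dot ('D_e2 X p) ('D_v ('D_e2 X) p)) = 0.
  move=> du dv; apply: (@near_zero_derive (fun q => dot ('D_e1 X q) ('D_e1 X q)
      - dot ('D_e2 X q) ('D_e2 X q)) p v).
    by apply: filterS near1 => q; exact: E.
  exact (is_derive_sqr_length_sub du dv).
have DF v : derivable ('D_e1 X) p v -> derivable ('D_e2 X) p v ->
    dot ('D_v ('D_e1 X) p) ('D_e2 X p) + dot ('D_e1 X p) ('D_v ('D_e2 X) p) = 0.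
  move=> du dv; apply: (@near_zero_derive (fun q => dot ('D_e1 X q) ('D_e2 X q)) p v).
    by apply: filterS near1 => q; exact: F.
  exact (is_derive_dot du dv).
have S nu := schwarz_dot (@open_disc R 1) (conf_C2 hX) nu p1.
have alg (xu xv xuu xuv xvu xvv : 'rV[R]_(2 + m)) :
    (forall nu, dot xuv nu = dot xvu nu) ->
    dot xuu xu + dot xu xuu - (dot xvu xv + dot xv xvu) = 0 ->
    dot xuv xu + dot xu xuv - (dot xvv xv + dot xv xvv) = 0 ->
    dot xuu xv + dot xu xvu = 0 -> dot xuv xv + dot xu xvv = 0 ->
    dot (xuu + xvv) xu = 0 /\ dot (xuu + xvv) xv = 0.
  move=> Suv; rewrite !dotDl ![dot xu _]dotC ![dot xv _]dotC !Suv.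
  by move=> *; split; lra.
exact (alg _ _ _ _ _ _ S (DE e1 duu dvu) (DE e2 duv dvv) (DF e1 duu dvu) (DF e2 duv dvv)).
Qed.

Lemma laplacian_conformal_minimal p : disc 1 p ->
  'D_e1 ('D_e1 X) p + 'D_e2 ('D_e2 X) p = 0.
Proof.
move=> p1; have qr := plane_map_disc p1.
have [C1 C11 C12] := conf_C2 hX; have [du dv _ _] := C1 p p1.
have [c1 c2 c3] := conf_conformal hX p1; rewrite enorm_sqr in c1; rewrite enorm_sqr in c2.
have jac := conf_jacobian hX p1; rewrite /plane_jacobian (derive_plane_map du) (derive_plane_map dv)/= in jac.
have [L1 L2] := conformal_orthogonal p1.
have M s := minimal_graph_equation (@open_disc R r) C2phi s hmin qr.
exact (conformal_laplacian_eq0 jac c1 c2 c3 M (conformal_chain p1) L1 L2).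
Qed.

Lemma harmonic_at_dot nu p : disc 1 p -> harmonic_at (fun q => dot (X q) nu) p.
Proof.
move=> p1; apply: (taylor2_harmonic (taylor2_dot (@open_disc R 1) (conf_C2 hX) nu p1)).
by rewrite -dotDl laplacian_conformal_minimal// /dot big1// => i _; rewrite mxE mul0r.
Qed.

End ConformalGraph.

(** * Discs and the radial retraction *)

Section DiscTopology.
Variable R : realType.
Implicit Types p q : R * R.

Lemma closure_disc (a : R) : 0 < a -> closure (disc a) = [set p | sqn p <= a ^+ 2].
Proof.
move=> a0; apply/seteqP; split.
  have cl : closed [set p : R * R | sqn p <= a ^+ 2].
    apply: (@closed_comp _ _ (@sqn R) [set x | x <= a ^+ 2]); last exact: closed_le.
    by move=> p _; exact: continuous_sqn.
  rewrite [X in _ `<=` X](closure_id _).1//; apply: closureS => p /= /ltW; exact.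
move=> p /= pa B pB.
pose w (t : R) := ((1 - t) * p.1, (1 - t) * p.2).
have cw : continuous w by rewrite /w; continuity.
have H := cvg_at_right_filter (cw 0).
have w0 : w 0 = p by rewrite /w subr0 !mul1r -surjective_pairing.
rewrite w0 in H; have near_B := H B pB.
have [t [t0 t1 tB]] : exists t : R, [/\ 0 < t, t < 1 & B (w t)].
  apply: (@filter_ex _ (0:R)^'+); near=> t; split.
  - by near: t; exact: nbhs_right_gt.
  - by near: t; exact: nbhs_right_lt.
  - by near: t.
exists (w t); split=> //; rewrite /disc /w/= !exprMn -mulrDr.
rewrite -/(sqn p); have a2 : 0 < a ^+ 2 by rewrite exprn_gt0.
apply: (@le_lt_trans _ _ ((1 - t) ^+ 2 * a ^+ 2)); first by rewrite ler_wpM2l ?sqr_ge0.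
by rewrite -[ltRHS]mul1r ltr_pM2r//; nra.
Unshelve. all: by end_near. Qed.

Lemma boundary_disc (a : R) : 0 < a -> boundary (disc a) = [set p | sqn p = a ^+ 2].
Proof.
move=> a0; rewrite /boundary closure_disc// (interior_id _).1; last exact: open_disc.
apply/seteqP; split => p /=; rewrite /disc/= -/(sqn p).
  by move=> [p1 /negP]; rewrite -leNgt => p2; apply/le_anti; rewrite p1.
by move=> ->; split; rewrite ?lexx// ltxx.
Qed.

(** [X] is controlled only on the closed disc, whereas the estimates above ask for functions
    continuous on the whole plane. Composing with this projection extends [X] continuously without
    changing it on the disc. *)
Definition retract p : R * R :=
  let k := Num.max 1 (Num.sqrt (sqn p)) in (k^-1 * p.1, k^-1 * p.2).

Lemma retract_id p : sqn p <= 1 -> retract p = p.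
Proof.
move=> p1; rewrite /retract max_l; last by rewrite -sqrtr1 ler_wsqrtr.
by rewrite invr1 !mul1r -surjective_pairing.
Qed.

Lemma sqn_retract p : sqn (retract p) <= 1.
Proof.
rewrite /sqn /retract /=; set k := Num.max _ _.
have k1 : 1 <= k by rewrite le_max lexx.
have kp : sqn p <= k ^+ 2.
  rewrite -[leLHS]sqr_sqrtr ?sqn_ge0// ler_sqr ?nnegrE ?sqrtr_ge0//.
    by rewrite le_max lexx orbT.
  by rewrite (le_trans ler01).
rewrite !exprMn -mulrDr exprVn mulrC ler_pdivrMr ?mul1r//.
by rewrite exprn_gt0// (lt_le_trans ltr01).
Qed.

Lemma continuous_retract : continuous retract.
Proof.
have ck : continuous (fun p : R * R => Num.max 1 (Num.sqrt (sqn p)) : R).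
  move=> p; apply: (@continuous_max R _ (fun=> 1) (fun p => Num.sqrt (sqn p)) p).
    exact: cst_continuous.
  by apply: (@continuous_comp _ _ _ (@sqn R) Num.sqrt); [exact: continuous_sqn|exact: sqrt_continuous].
have cv : continuous (fun p : R * R => (Num.max 1 (Num.sqrt (sqn p)))^-1 : R).
  move=> p; apply: cvgV; last exact: ck.
  by rewrite gt_eqF// lt_max ltr01.
by rewrite /retract; continuity.
Qed.

End DiscTopology.

Section HessianBound.
Variable R : realType.

Lemma taylor2_near (f g : R * R -> R) p b c d e k : (\forall q \near p, f q = g q) ->
  taylor2 f p b c d e k -> taylor2 g p b c d e k.
Proof.
move=> fg tf eps eps0; have fgp := nbhs_singleton fg.
have [r r0 rP] := near_square fg.
apply: filterS (filterI (near_zero_square r0) (tf eps eps0)) => h [[h1 h2]]; rewrite fgp rP//=; first by rewrite addrC addKr.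
by rewrite addrC addKr.
Qed.

(** Rotate [f] so that [(c, s)] becomes the first axis, apply [harmonic_second_difference] at
    [(t, 0)], divide by [t^2] and let [t] tend to 0. *)
Lemma hessian_bound (f : R * R -> R) (M b1 b2 d e k c s : R) : continuous f ->
  (forall p, sqn p < 1 -> harmonic_at f p) ->
  (forall p, sqn p <= 1 -> `|f p| <= M) ->
  taylor2 f (0, 0) b1 b2 d e k -> c ^+ 2 + s ^+ 2 = 1 ->
  (d - k) * (c ^+ 2 - s ^+ 2) + 4 * e * (c * s) <= 8 * M.
Proof.
move=> cf hf fM tf cs.
pose g (q : R * R) := f (c * q.1 + - s * q.2, 1 * (c * q.2 - - s * q.1)).
have rot q : sqn (c * q.1 + - s * q.2, 1 * (c * q.2 - - s * q.1)) = sqn q.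
  rewrite [LHS](_ : _ = (c ^+ 2 + s ^+ 2) * sqn q); first by rewrite cs mul1r.
  by rewrite /sqn/=; ring.
have cg : continuous g by apply: continuous_pair_comp => //; continuity.
have hg p : sqn p < 1 -> harmonic_at g p.
  by move=> p1; apply: harmonic_at_conformal; [left|apply: hf; rewrite rot].
have gM p : sqn p <= 1 -> `|g p| <= M by move=> p1; apply: fM; rewrite rot.
have H := harmonic_second_difference cg hg gM.
have := expansionD (taylor2_line (h1 := c) (h2 := s) tf) (taylor2_line (h1 := - c) (h2 := - s) tf).
move=> E1; have := expansionD (taylor2_line (h1 := - s) (h2 := c) tf) (taylor2_line (h1 := s) (h2 := - c) tf).
move=> E2; have {E1 E2} := cvgB E1 E2.
set lim := (X in _ --> X) => /(_ (at_right_proper_filter (0 : R))) E.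
have -> : (d - k) * (c ^+ 2 - s ^+ 2) + 4 * e * (c * s) = lim by rewrite /lim; field.
apply: (cvgr_to_le E); near=> t.
have t0 : 0 < t by near: t; exact: nbhs_right_gt.
have t1 : t < 1 by near: t; exact: nbhs_right_lt.
have t01 : 0 <= t <= 1 by rewrite !ltW.
have := H t t01; rewrite -ler_pdivrMr ?exprn_gt0// /g/= => Ht.
apply: le_trans Ht; rewrite fctE/= -mulrBl ler_wpM2r ?invr_ge0 ?sqr_ge0//.
have A1 : (c * t + - s * 0, 1 * (c * 0 - - s * t)) = (0 + t * c, 0 + t * s) :> R * R.
  by congr (_, _); ring.
have A2 : (c * - t + - s * 0, 1 * (c * 0 - - s * - t)) = (0 + t * - c, 0 + t * - s) :> R * R.
  by congr (_, _); ring.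
have A3 : (c * 0 + - s * t, 1 * (c * t - - s * 0)) = (0 + t * - s, 0 + t * c) :> R * R.
  by congr (_, _); ring.
have A4 : (c * 0 + - s * - t, 1 * (c * - t - - s * 0)) = (0 + t * s, 0 + t * - c) :> R * R.
  by congr (_, _); ring.
by rewrite A1 A2 A3 A4; lra.
Unshelve. all: by end_near. Qed.

End HessianBound.

Lemma dot_opp (R : realType) k (nu x y : 'rV[R]_k) : x + y = 0 -> dot y nu = - dot x nu.
Proof.
move=> /eqP; rewrite addrC addr_eq0 => /eqP ->.
by rewrite -scaleN1r dotZl mulN1r.
Qed.

(** A vanishing Laplacian gives [k1 + k2 = 0], so the sum of squares is [- 2 k1 k2]. *)
Lemma sum_sqr_principal_curvatures (R : realType) k (xu xv xuu xuv xvv nu : 'rV[R]_k)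
    (W k1 k2 : R) : 0 < W -> dot xu xu = W -> dot xv xv = W -> dot xu xv = 0 ->
  xuu + xvv = 0 ->
  (dot xuu nu * dot xv xv - 2 * dot xuv nu * dot xu xv + dot xvv nu * dot xu xu)
    / (2 * W ^+ 2) = (k1 + k2) / 2 ->
  (dot xuu nu * dot xvv nu - dot xuv nu ^+ 2) / W ^+ 2 = k1 * k2 ->
  k1 ^+ 2 + k2 ^+ 2 = 2 * (dot xuu nu ^+ 2 + dot xuv nu ^+ 2) / W ^+ 2.
Proof.
move=> W0 -> -> -> /(dot_opp nu) -> hH hK; have Wn : W != 0 by rewrite gt_eqF.
have K0 : k1 + k2 = 0.
  have : (k1 + k2) / 2 = 0 by rewrite -hH; field.
  by lra.
have -> : k1 ^+ 2 + k2 ^+ 2 = (k1 + k2) ^+ 2 - 2 * (k1 * k2) by ring.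
by rewrite K0 -hK; field.
Qed.

Lemma curvature_estimate (R : realType) (r W M K a b : R) : 0 < r -> 0 < K ->
  r ^+ 2 / K <= W -> a ^+ 2 <= 16 * M ^+ 2 -> b ^+ 2 <= 16 * M ^+ 2 ->
  2 * (a ^+ 2 + b ^+ 2) / W ^+ 2 <= 1 / r ^+ 4 * (64 * K ^+ 2) * M ^+ 2.
Proof.
move=> r0 K0 WR a2 b2; have rn : r != 0 by rewrite gt_eqF.
have Kn : K != 0 by rewrite gt_eqF.
have rK : 0 < r ^+ 2 / K by rewrite divr_gt0// exprn_gt0.
have W0 := lt_le_trans rK WR.
have W2 : (r ^+ 2 / K) ^+ 2 <= W ^+ 2 by rewrite ler_sqr ?nnegrE ?(ltW W0) ?(ltW rK).
rewrite ler_pdivrMr ?exprn_gt0//.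
apply: (@le_trans _ _ (64 * M ^+ 2)); first by lra.
have -> : 64 * M ^+ 2 = 1 / r ^+ 4 * (64 * K ^+ 2) * M ^+ 2 * (r ^+ 2 / K) ^+ 2.
  by field; rewrite rn Kn.
rewrite ler_wpM2l// mulr_ge0 ?sqr_ge0// mulr_ge0//.
  by rewrite divr_ge0// exprn_ge0// ltW.
by rewrite mulr_ge0 ?sqr_ge0.
Qed.

(** * Area and curvature bounds at the origin *)

Section CurvatureBound.
Variables (R : realType) (m : nat) (r : R) (phi : 'I_m -> R * R -> R).
Variable X : R * R -> 'rV[R]_(2 + m).
Implicit Types (p q : R * R) (nu : 'rV[R]_(2 + m)).
Hypothesis r0 : 0 < r.
Hypotheses (C2phi : forall s, C2_on (disc r) (phi s)) (hmin : minimal (disc r) (graph phi)).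
Hypothesis hX : conformal_parameters r phi X.

Lemma closure_disc1 : closure (disc 1) = [set p : R * R | sqn p <= 1].
Proof. by rewrite closure_disc// expr1n. Qed.

Lemma boundary_disc1 : boundary (disc 1) = [set p : R * R | sqn p = 1].
Proof. by rewrite boundary_disc// expr1n. Qed.

Lemma sqn_lt1_disc (p : R * R) : sqn p < 1 -> disc 1 p.
Proof. by rewrite /disc/= expr1n. Qed.

Lemma disc_sqn_lt1 (p : R * R) : disc 1 p -> sqn p < 1.
Proof. by rewrite /disc/= expr1n. Qed.

(** An interior point sent to the boundary circle would share its image with a boundary point, as
    the boundary map is onto; injectivity on the closed disc forbids this. *)
Lemma plane_map_disc p : disc 1 p -> disc r (plane_map X p).
Proof.
move=> p1; have cp : closure (disc 1) p by exact: subset_closure.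
have := conf_maps hX cp; rewrite closure_disc// /disc/= -/(sqn (plane_map X p)) => H.
rewrite lt_neqAle H andbT; apply/eqP => E.
have [_ _ [g [gB _ _ Fg]]] := conf_boundary hX.
have bp : boundary (disc r) (plane_map X p) by rewrite boundary_disc.
have gp := gB _ bp.
have cgp : closure (disc 1) (g (plane_map X p)) by case: gp.
have pg := conf_inj hX cp cgp (esym (Fg _ bp)).
by move: gp; rewrite boundary_disc1 /= -pg; have := disc_sqn_lt1 p1; lra.
Qed.

Lemma continuous_dot_retract nu : continuous (fun p => dot (X (retract p)) nu).
Proof.
move=> p; apply: (@continuous_dotl _ _ (fun q => X (retract q))).
apply: (continuous_comp_within (conf_C0 hX) (@continuous_retract R)) => q.
by rewrite closure_disc1; exact: sqn_retract.
Qed.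

Lemma near_retract p : sqn p < 1 -> \forall q \near p, retract q = q.
Proof.
move=> p1; have near1 := open_nbhs_nbhs (conj (@open_disc R 1) (sqn_lt1_disc p1)).
by apply: filterS near1 => q /disc_sqn_lt1/ltW; exact: retract_id.
Qed.

Lemma harmonic_at_dot_retract nu p : sqn p < 1 ->
  harmonic_at (fun q => dot (X (retract q)) nu) p.
Proof.
move=> p1; have h := harmonic_at_dot C2phi hmin hX plane_map_disc nu (sqn_lt1_disc p1).
apply: harmonic_at_near h.
by apply: filterS (near_retract p1) => q ->.
Qed.

Lemma taylor2_dot_retract nu p : sqn p < 1 -> taylor2 (fun q => dot (X (retract q)) nu) p
  (dot ('D_e1 X p) nu) (dot ('D_e2 X p) nu) (dot ('D_e1 ('D_e1 X) p) nu)
  (dot ('D_e2 ('D_e1 X) p) nu) (dot ('D_e2 ('D_e2 X) p) nu).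
Proof.
move=> p1; have t := taylor2_dot (@open_disc R 1) (conf_C2 hX) nu (sqn_lt1_disc p1).
apply: taylor2_near t.
by apply: filterS (near_retract p1) => q ->.
Qed.

(** Without boundedness [sup] would carry no information; compactness of the closed disc supplies
    it. *)
Lemma has_ubound_enorm : has_ubound [set enorm (X p) | p in disc (1 : R)].
Proof.
have cu : continuous (fun p => dot (X (retract p)) (X (retract p))).
  rewrite /dot.
  have -> : (fun p => \sum_i X (retract p) 0 i * X (retract p) 0 i)
    = \sum_i (fun p => X (retract p) 0 i * X (retract p) 0 i).
    by apply/funext => q; rewrite fct_sumE.
  apply: (big_ind (fun f : R * R -> R => continuous f)).
  - exact: cst_continuous.
  - by move=> f g cf cg p; apply: cvgD; [exact: cf|exact: cg].
  - move=> i _.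
    have ci : continuous (fun p => X (retract p) 0 i).
      have -> : (fun p => X (retract p) 0 i) = (fun p => dot (X (retract p)) (delta_mx 0 i)).
        by apply/funext => p; rewrite dot_delta.
      exact: continuous_dot_retract.
    by continuity.
have [|c _ cmax] := compact_EVT_max _ (@compact_cdisc R) (continuous_subspaceT cu).
  by exists (0, 0); rewrite /cdisc /sqn/=; lra.
exists (enorm (X (retract c))) => _ [p /disc_sqn_lt1 p1 <-].
rewrite /enorm ler_wsqrtr//.
by have := cmax p (mem_set (ltW p1)); rewrite (retract_id (ltW p1)).
Qed.

Lemma dot_unit_le (x nu : 'rV[R]_(2 + m)) : enorm nu = 1 -> `|dot x nu| <= enorm x.
Proof.
move=> nu1; have nn : dot nu nu = 1 by rewrite -enorm_sqr nu1 expr1n.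
have := dot_ge0 (x + - dot x nu *: nu).
rewrite !(dotDl, dotDr, dotZl, dotZr) nn [dot nu x]dotC => H.
have : dot x nu ^+ 2 <= enorm x ^+ 2 by rewrite enorm_sqr; lra.
by rewrite -ler_sqrt ?sqr_ge0// !sqrtr_sqr (ger0_norm (sqrtr_ge0 _)).
Qed.

(** The supremum is over the open disc only; the bound reaches the circle because it defines a
    closed set. *)
Lemma dot_retract_bound nu p : enorm nu = 1 -> sqn p <= 1 ->
  `|dot (X (retract p)) nu| <= C0_norm X.
Proof.
move=> nu1 p1.
have cl : closed [set p | `|dot (X (retract p)) nu| <= C0_norm X].
  apply: (@closed_comp _ _ (fun p => `|dot (X (retract p)) nu|) [set x | x <= C0_norm X]).
    by move=> q _; apply: cvg_norm; exact: continuous_dot_retract.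
  exact: closed_le.
suff sub : disc 1 `<=` [set p | `|dot (X (retract p)) nu| <= C0_norm X].
  have := closureS sub; rewrite closure_disc1 -(closure_id _).1//; exact.
move=> q q1 /=; have q1' := disc_sqn_lt1 q1.
rewrite (retract_id (ltW q1')); apply: le_trans (dot_unit_le _ nu1) _.
by apply: ub_le_sup; [exact: has_ubound_enorm|exists q].
Qed.

Lemma origin_lt1 : sqn ((0, 0) : R * R) < 1.
Proof. by rewrite /sqn/=; lra. Qed.

Lemma conformal_hessian_bound nu : enorm nu = 1 ->
  let d := dot ('D_e1 ('D_e1 X) (0, 0)) nu in let e := dot ('D_e2 ('D_e1 X) (0, 0)) nu in
  d ^+ 2 <= 16 * C0_norm X ^+ 2 /\ e ^+ 2 <= 16 * C0_norm X ^+ 2.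
Proof.
move=> nu1 d e.
have L0 : dot ('D_e2 ('D_e2 X) (0, 0)) nu = - d.
  exact (dot_opp nu (laplacian_conformal_minimal C2phi hmin hX plane_map_disc
    (sqn_lt1_disc origin_lt1))).
have tr (f : R * R -> R) (b1 b2 d' e' x y : R) : x = y ->
  taylor2 f (0, 0) b1 b2 d' e' x -> taylor2 f (0, 0) b1 b2 d' e' y by move=> ->.
have T : taylor2 (fun q => dot (X (retract q)) nu) (0, 0) (dot ('D_e1 X (0, 0)) nu)
    (dot ('D_e2 X (0, 0)) nu) d e (- d).
  exact (tr _ _ _ _ _ _ _ L0 (taylor2_dot_retract nu origin_lt1)).
clear L0 tr; clearbody d e.
have B (c s : R) := hessian_bound (c := c) (s := s) (@continuous_dot_retract nu)
  (harmonic_at_dot_retract nu) (fun p => dot_retract_bound nu1) T.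
have cs1 : (1 : R) ^+ 2 + 0 ^+ 2 = 1 by ring.
have cs2 : (0 : R) ^+ 2 + 1 ^+ 2 = 1 by ring.
pose q : R := cos (pi / 4); have q2 : q ^+ 2 = 1 / 2 by exact: cos_pi4_sqr.
have cs3 : q ^+ 2 + q ^+ 2 = 1 by rewrite q2; lra.
have cs4 : q ^+ 2 + (- q) ^+ 2 = 1 by rewrite sqrrN.
(* These four directions bound [2 d], [- 2 d], [2 e] and [- 2 e] by [8 M]. *)
move: (B _ _ cs1) (B _ _ cs2) (B _ _ cs3) (B _ _ cs4).
rewrite mulrN -expr2 sqrrN q2; set M := C0_norm X.
move=> B1 B2 B3 B4.
have sq (x : R) : x <= 4 * M -> - x <= 4 * M -> x ^+ 2 <= 16 * M ^+ 2.
  move=> x1 x2; have : 0 <= (4 * M - x) * (4 * M + x) by rewrite mulr_ge0; lra.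
  by lra.
by split; apply: sq; lra.
Qed.

Lemma conformal_area_bound : r ^+ 2 / 4096 <= area_element X (0, 0).
Proof.
have [c1 c2 _] := conf_conformal hX (sqn_lt1_disc origin_lt1).
rewrite enorm_sqr in c1; rewrite enorm_sqr in c2.
set W := area_element X (0, 0) in c1 c2 *.
pose F p := plane_map X p.
have bF : homeomorphism_between [set p | sqn p = 1] [set p | sqn p = r ^+ 2] F.
  by have := conf_boundary hX; rewrite boundary_disc1 boundary_disc.
have [FB _ [g [gB cg gF Fg]]] := bF.
(* The angles 0 and [pi / 2] select the first and second coordinates of the plane map. *)
have [b1 [b2 [d [b bd lF1]]]] := exists_sign_line 0 r0 FB gB cg gF Fg.
have [a1 [a2 [e [a ae lF2]]]] := exists_sign_line (pi / 2) r0 FB gB cg gF Fg.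
rewrite cos0 sin0 in lF1; rewrite cos_pihalf sin_pihalf in lF2.
pose nu0 : 'rV[R]_(2 + m) := delta_mx 0 0; pose nu1 : 'rV[R]_(2 + m) := delta_mx 0 1.
pose f1 p := dot (X (retract p)) nu0; pose f2 p := dot (X (retract p)) nu1.
have fF p : sqn p <= 1 -> f1 p = (F p).1 /\ f2 p = (F p).2.
  by move=> p1; rewrite /f1 /f2 !dot_delta retract_id.
have F0 := conf_origin hX; have [f10 f20] := fF (0, 0) (ltW origin_lt1).
rewrite /F F0 /= in f10 f20.
have fr w : sqn w = 1 -> f1 w ^+ 2 + f2 w ^+ 2 = r ^+ 2.
  by move=> w1; have [|-> ->] := fF w; [rewrite w1|exact: FB].
have l1 w : sqn w = 1 -> 0 <= (b1 * w.1 + b2 * w.2 - d) * f1 w.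
  move=> w1; have [|-> _] := fF w; first by rewrite w1.
  by have := lF1 w w1; rewrite mul1r mul0r addr0.
have l2 w : sqn w = 1 -> 0 <= (a1 * w.1 + a2 * w.2 - e) * f2 w.
  move=> w1; have [|_ ->] := fF w; first by rewrite w1.
  by have := lF2 w w1; rewrite mul0r mul1r add0r.
have two (x : 'rV[R]_(2 + m)) : dot x nu0 ^+ 2 + dot x nu1 ^+ 2 <= dot x x.
  rewrite !dot_delta {3 4}[x]gvec_eta dot_gvec/= -!expr2 lerDl sumr_ge0// => s _.
  by rewrite -expr2 sqr_ge0.
have alg (x y : 'rV[R]_(2 + m)) (A : R) : dot x x = A -> dot y y = A ->
    r ^+ 2 / 2048 <= dot x nu0 ^+ 2 + dot y nu0 ^+ 2 + dot x nu1 ^+ 2 + dot y nu1 ^+ 2 ->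
    r ^+ 2 / 4096 <= A.
  by move=> xA yA; have := two x; have := two y; rewrite xA yA; lra.
have H := heinz_gradient r0 (@continuous_dot_retract nu0) (@continuous_dot_retract nu1)
  (harmonic_at_dot_retract nu0) (harmonic_at_dot_retract nu1) f10 f20
  (taylor2_odd_derivative (taylor2_dot_retract nu0 origin_lt1))
  (taylor2_odd_derivative (taylor2_dot_retract nu1 origin_lt1)) fr b bd l1 a ae l2.
exact (alg _ _ _ c1 c2 H).
Qed.

Lemma principal_curvature_bound N k1 k2 : unit_normal_field (disc 1) X N ->
  principal_curvatures X N (0, 0) k1 k2 ->
  k1 ^+ 2 + k2 ^+ 2 <= 1 / r ^+ 4 * (64 * 4096 ^+ 2) * C0_norm X ^+ 2.
Proof.
move=> hN [hH hK]; have o1 := sqn_lt1_disc origin_lt1.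
have [_ nu1 _ _] := hN _ o1; have [d2 e2] := conformal_hessian_bound nu1.
have WR := conformal_area_bound.
have K0 : 0 < 4096 :> R by rewrite ltr0n.
have W0 := lt_le_trans (divr_gt0 (exprn_gt0 2 r0) K0) WR.
have [c1 c2 c3] := conf_conformal hX o1; rewrite enorm_sqr in c1; rewrite enorm_sqr in c2.
have L0 := laplacian_conformal_minimal C2phi hmin hX plane_map_disc o1.
rewrite (sum_sqr_principal_curvatures W0 c1 c2 c3 L0 hH hK).
exact (curvature_estimate r0 K0 WR d2 e2).
Qed.

End CurvatureBound.

Theorem mainTheorem1 (R : realType) :
  exists2 Theta : R, 0 < Theta &
  forall (n : nat) (hn : (3 <= n)%N) (r : R) (hr : 0 < r)
    (phi : 'I_(n - 2) -> R * R -> R)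
    (hphi : forall s, C2_closure (disc r) (phi s))
    (hmin : minimal (disc r) (graph phi))
    (X : R * R -> 'rV[R]_(2 + (n - 2)))
    (hX : conformal_parameters r phi X)
    (N : R * R -> 'rV[R]_(2 + (n - 2)))
    (hN : unit_normal_field (disc 1) X N)
    (k1 k2 : R) (hk : principal_curvatures X N (0, 0) k1 k2),
  k1 ^+ 2 + k2 ^+ 2 <= 1 / r ^+ 4 * Theta * C0_norm X ^+ 2.
Proof.
exists (64 * 4096 ^+ 2); first by rewrite mulr_gt0 ?exprn_gt0 ?ltr0n.
move=> n hn r hr phi hphi hmin X hX N hN k1 k2 hk.
have C2phi s : C2_on (disc r) (phi s) by have [] := hphi s.
exact (principal_curvature_bound hr C2phi hmin hX hN hk).
Qed.
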